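(* Let $\overline{M}^{n+q}$ be an $(n+q)$-dimensional connected oriented Riemannian manifold, $P^n\subset\overline{M}^{n+q}$ an oriented connected totally geodesic $n$-dimensional submanifold, and $\Sigma^{n-1}\subset P^n$ a compact hypersurface of $P^n$. Let $\Psi:M^n\to\overline{M}^{n+q}$ be an oriented connected compact submanifold with boundary $\Sigma^{n-1}=\Psi(\partial M)$. If for some multi-index $u\in\mathbb{N}^q$ with $1\le|u|\le n-1$ the generalized Newton transformation $T_u=T_u(A_1,\dots,A_q)$ is positive definite on $M^n$, then $M^n$ and $P^n$ are transversal along $\partial M$.
   Context: Multi-indices: $\mathbb{N}$ is the set of nonnegative integers. For $u=(u_1,\dots,u_q)\in\mathbb{N}^q$, $|u|=u_1+\dots+u_q$ and $t^u=t_1^{u_1}\cdots t_q^{u_q}$; $\alpha_\flat(u)$ is $u$ with its $\alpha$-th entry decreased by $1$. Generalized Newton transformations: for endomorphisms $A=(A_1,\dots,A_q)$ of a finite-dimensional real vector space $E$, $\sigma_u=\sigma_u(A)$ are defined by $\det(I+t_1A_1+\dots+t_qA_q)=\sum_{u}\sigma_u t^u$ ($\sigma_u=0$ if $|u|>\dim E$). The endomorphisms $T_u=T_u(A)$ are defined by $T_0=I$ (with $0=(0,\dots,0)$), $T_u=\sigma_uI-\sum_{\alpha=1}^q A_\alpha T_{\alpha_\flat(u)}$ for $|u|\ge1$, where $T_v=0$ if $v$ has a negative entry. Geometry: $\langle\cdot,\cdot\rangle$ and $\overline\nabla$ are the metric and Levi-Civita connection of $\overline{M}^{n+q}$. That $M^n$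 is a submanifold with boundary $\Sigma^{n-1}$ means $\Psi$ is an immersion whose restriction to $\partial M$ is a diffeomorphism onto $\Sigma^{n-1}$; $\partial M$ is identified with $\Sigma^{n-1}$. At each point of $M^n$, $N_1,\dots,N_q$ is a fixed orthonormal basis of the normal space of $M^n$ in $\overline{M}^{n+q}$, and $A_\alpha$ is the shape operator of $M^n$ in direction $N_\alpha$: $\langle A_\alpha X,Y\rangle=\langle\overline\nabla_XY,N_\alpha\rangle$ for $X,Y$ tangent to $M^n$. $T_u$ positive definite on $M^n$ means $\langle T_uX,X\rangle>0$ for every nonzero tangent vector $X$ at every point of $M^n$. $\eta$ is a unit normal vector field of $\Sigma^{n-1}$ in $P^n$. Transversality (the paper's sense): $M^n$ and $P^n$ are not transversal along $\partial M$ if there exists $p\in\partial M$ such that $\langle\eta,N_\alpha\rangle=0$ at $p$ for every $\alpha\in\{1,\dots,q\}$; otherwise they are transversal along $\partial M$. That is, they are transversal along $\partial M$ when at every $p\in\partial M$ there is some $\alpha$ with $\langle\eta,N_\alpha\rangle\neq0$. *)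

(* Defs.v *)
From HB Require Import structures.
From mathcomp Require Import all_boot all_order all_algebra.
From mathcomp Require Import all_classical all_reals all_analysis.
(* The notations of mpoly clash with those of the analysis library. *)
From mathcomp Require mpoly.
Import -(notations) mpoly.
Set Implicit Arguments.
Unset Strict Implicit.
Unset Printing Implicit Defensive.
Import Order.TTheory GRing.Theory Num.Theory.
Import numFieldNormedType.Exports.
Local Open Scope classical_set_scope.
Local Open Scope ring_scope.

(* Multi-indices in N^q are the monomials mpoly.multinom q, with
   |u| = mpoly.mdeg u.  The variables t_1, ..., t_q of the generating function
   are the indeterminates of {mpoly R[q]}. *)
Definition sigma (R : realType) (n q : nat) (A : 'I_q -> 'M[R]_n)
    (u : mpoly.multinom q) : R :=
  mpoly.mcoeff u
    (\det (1%:M + \sum_(a < q) mpoly.mpolyX R (mpoly.mnm1 a)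
                    *: map_mx (@mpoly.mpolyC q R) (A a))).

(* The terms with u_a = 0 are those for which u with its a-th entry decreased
   by 1 has a negative entry. The recursion is on k = |u|, see newtonTE. *)
Fixpoint newtonT_rec (R : realType) (n q : nat) (A : 'I_q -> 'M[R]_n)
    (k : nat) (u : mpoly.multinom q) : 'M[R]_n :=
  match k with
  | 0%N => 1%:M
  | k'.+1 =>
    (sigma A u)%:M
    - \sum_(a < q | (0 < mpoly.fun_of_multinom u a)%N)
        A a *m newtonT_rec A k' (mpoly.mnm_sub u (mpoly.mnm1 a))
  end.

Definition newtonT (R : realType) (n q : nat) (A : 'I_q -> 'M[R]_n)
    (u : mpoly.multinom q) : 'M[R]_n := newtonT_rec A (mpoly.mdeg u) u.

Lemma newtonT0 (R : realType) (n q : nat) (A : 'I_q -> 'M[R]_n) :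
  newtonT A mpoly.mnm0 = 1%:M.
Proof. by rewrite /newtonT mpoly.mdeg0. Qed.

Lemma newtonTE (R : realType) (n q : nat) (A : 'I_q -> 'M[R]_n)
    (u : mpoly.multinom q) : (0 < mpoly.mdeg u)%N ->
  newtonT A u = (sigma A u)%:M
    - \sum_(a < q | (0 < mpoly.fun_of_multinom u a)%N)
        A a *m newtonT A (mpoly.mnm_sub u (mpoly.mnm1 a)).
Proof.
rewrite {1}/newtonT; case E: (mpoly.mdeg u) => [//|k] _ /=.
congr (_ - _); apply: eq_bigr => a ua; congr (_ *m _).
have le1u : lem (mnm1 a) u by rewrite lep1mP -lt0n.
suff -> : k = mdeg (mnm_sub u (mnm1 a)) by [].
by move: E; rewrite -{1}(submK le1u) mdegD mdeg1 addn1 => -[].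
Qed.

Fixpoint Ck (R : realType) (r m : nat) (W : normedModType R)
    (V : set 'cV[R]_m) (G : 'cV[R]_m -> W) : Prop :=
  match r with
  | 0%N => forall x, V x -> {for x, continuous G}
  | r'.+1 => (forall x, V x -> differentiable G x) /\
      forall i : 'I_m, Ck r' V (fun x => 'D_(delta_mx i 0) G x)
  end.

(* Smoothness on an arbitrary subset A: locally, f is the restriction to A of a
   C^oo function on an open set. *)
Definition smooth_on (R : realType) (m : nat) (W : normedModType R)
    (A : set 'cV[R]_m) (f : 'cV[R]_m -> W) : Prop :=
  forall x, A x -> exists (V : set 'cV[R]_m) (G : 'cV[R]_m -> W),
    [/\ open V, V x, (forall r, Ck r V G) & forall y, A y -> V y -> f y = G y].

(* R^m, or the half-space {x | 0 <= x_0} when bd is true. *)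
Definition model (R : realType) (bd : bool) (m : nat) : set 'cV[R]_m :=
  [set x | bd -> forall i : 'I_m, val i = 0%N -> 0 <= x i 0].
Arguments model R bd m : clear implicits.

(* Partial derivative with increments kept inside D; it is one-sided at a
   boundary point of a half-space. *)
Definition pderiv (R : realType) (m : nat) (W : normedModType R)
    (D : set 'cV[R]_m) (f : 'cV[R]_m -> W) (x : 'cV[R]_m) (i : 'I_m) : W :=
  lim ((fun t : R => t^-1 *: (f (x + t *: delta_mx i 0) - f x))
         @ within [set t : R | D (x + t *: delta_mx i 0)] 0^').

Record chart (R : realType) (m : nat) (M : topologicalType) := Chart {
  cdom : set M;
  cmap : M -> 'cV[R]_m;
  cinv : 'cV[R]_m -> M
}.

Definition is_chart (R : realType) (bd : bool) (m : nat) (M : topologicalType)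
    (c : chart R m M) : Prop :=
  [/\ open (cdom c),
      (exists2 V, open V & cmap c @` cdom c = V `&` model R bd m),
      (forall p, cdom c p -> cinv c (cmap c p) = p),
      {within cdom c, continuous (cmap c)} &
      {within cmap c @` cdom c, continuous (cinv c)}].

(* A manifold with boundary (possibly empty) when bd is true, without boundary
   when bd is false. Smooth means C^oo. *)
Record manifold (R : realType) (bd : bool) (m : nat) := Manifold {
  carrier :> topologicalType;
  atlas : set (chart R m carrier);
  chart_at : carrier -> chart R m carrier;
  _ : hausdorff_space carrier;
  _ : @second_countable carrier;
  _ : forall c, atlas c -> is_chart bd c;
  _ : forall c d, atlas c -> atlas d ->
        smooth_on (cmap c @` (cdom c `&` cdom d)) (cmap d \o cinv c);
  _ : forall p, atlas (chart_at p);
  _ : forall p, cdom (chart_at p) p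
}.

(* The tangent space T_pM is 'cV[R]_m: a vector is given by its components in
   the chart chart_at p selected at p. *)

(* Directional derivative at p, in the direction X \in T_pM, of a
   vector-valued function defined near p. *)
Definition mderiv (R : realType) (bd : bool) (m : nat) (M : manifold R bd m)
    (W : normedModType R) (p : M) (h : M -> W) (X : 'cV[R]_m) : W :=
  \sum_(i < m) X i 0 *:
    pderiv (model R bd m) (h \o cinv (chart_at p)) (cmap (chart_at p) p) i.

Definition smooth_at (R : realType) (bd : bool) (m : nat) (M : manifold R bd m)
    (W : normedModType R) (A : set M) (h : M -> W) (p : M) : Prop :=
  exists U : set M, [/\ open U, U p, U `<=` cdom (chart_at p) &
    smooth_on (cmap (chart_at p) @` (U `&` A)) (h \o cinv (chart_at p))].

Definition smooth_map (R : realType) (bd bd' : bool) (m k : nat)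
    (M : manifold R bd m) (N : manifold R bd' k) (A : set M) (F : M -> N)
    : Prop :=
  forall p, A p ->
    (exists U : set M, [/\ open U, U p &
       forall x, U x -> A x -> cdom (chart_at (F p)) (F x)]) /\
    smooth_at A (cmap (chart_at (F p)) \o F) p.

Definition mdiff (R : realType) (bd bd' : bool) (m k : nat)
    (M : manifold R bd m) (N : manifold R bd' k) (F : M -> N) (p : M)
    (X : 'cV[R]_m) : 'cV[R]_k :=
  mderiv p (cmap (chart_at (F p)) \o F) X.

Definition immersion (R : realType) (bd bd' : bool) (m k : nat)
    (M : manifold R bd m) (N : manifold R bd' k) (F : M -> N) : Prop :=
  smooth_map setT F /\ forall p, injective (mdiff F p).

Definition mboundary (R : realType) (bd : bool) (m : nat) (M : manifold R bd m)
    : set M :=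
  [set p | ~ (model R bd m)° (cmap (chart_at p) p)].
Arguments mboundary {R bd m} M.

Definition diffeo_from (R : realType) (bd bd' : bool) (m k : nat)
    (M : manifold R bd m) (N : manifold R bd' k) (A : set M) (f : M -> N)
    : Prop :=
  smooth_map A f /\ exists e : N -> M,
    [/\ smooth_map setT e, (forall s, A (e s)), (forall s, f (e s) = s) &
        forall p, A p -> e (f p) = p].

(* o p tells whether the frame of chart_at p at p is positively oriented. *)
Definition orientation (R : realType) (bd : bool) (m : nat)
    (M : manifold R bd m) (o : M -> bool) : Prop :=
  forall p, exists U : set M, [/\ open U, U p, U `<=` cdom (chart_at p) &
    forall x, U x -> (o x == o p) =
      (0 < \det (\matrix_(i, j)
                   mderiv x (cmap (chart_at p)) (delta_mx j 0) i 0))].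

(* A vector field along F assigns to every x a vector V x \in T_{F x}N.
   rep F p V x is the column of components of V x in the chart selected at
   F p, for x near p. *)
Definition rep (R : realType) (bd bd' : bool) (m k : nat)
    (M : manifold R bd m) (N : manifold R bd' k) (F : M -> N) (p : M)
    (V : M -> 'cV[R]_k) (x : M) : 'cV[R]_k :=
  mderiv (F x) (cmap (chart_at (F p))) (V x).

Definition smooth_along (R : realType) (bd bd' : bool) (m k : nat)
    (M : manifold R bd m) (N : manifold R bd' k) (F : M -> N) (U : set M)
    (V : M -> 'cV[R]_k) : Prop :=
  forall p, U p -> smooth_at U (rep F p V) p.

Definition smooth_field (R : realType) (bd : bool) (m : nat)
    (M : manifold R bd m) (U : set M) (X : M -> 'cV[R]_m) : Prop :=
  smooth_along id U X.

Definition bracket (R : realType) (bd : bool) (m : nat) (M : manifold R bd m)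
    (X Y : M -> 'cV[R]_m) (p : M) : 'cV[R]_m :=
  mderiv p (rep id p Y) (X p) - mderiv p (rep id p X) (Y p).

(* g p is the Gram matrix of the frame of chart_at p at p. *)
Definition inner (R : realType) (bd : bool) (m : nat) (M : manifold R bd m)
    (g : M -> 'M[R]_m) (p : M) (v w : 'cV[R]_m) : R :=
  (v^T *m g p *m w) 0 0.

Definition riemannian (R : realType) (bd : bool) (m : nat)
    (M : manifold R bd m) (g : M -> 'M[R]_m) : Prop :=
  [/\ forall p v w, inner g p v w = inner g p w v,
      forall p v, v != 0 -> 0 < inner g p v v &
      forall (U : set M) X Y, open U -> smooth_field U X -> smooth_field U Y ->
        forall p, U p -> smooth_at U (fun x => inner g x (X x) (Y x)) p].

(* G p i j is the covariant derivative at p of the j-th coordinate field of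
   chart_at p in the direction of the i-th one.  Only the values at p in the
   chart chart_at p are recorded, so no transformation law is involved. *)
Definition connection (R : realType) (bd : bool) (m : nat)
    (M : manifold R bd m) : Type := M -> 'I_m -> 'I_m -> 'cV[R]_m.

(* Covariant derivative at p, in the direction X \in T_pM, of a vector field V
   along F. *)
Definition cov (R : realType) (bd bd' : bool) (m k : nat)
    (M : manifold R bd m) (N : manifold R bd' k) (G : connection N)
    (F : M -> N) (p : M) (X : 'cV[R]_m) (V : M -> 'cV[R]_k) : 'cV[R]_k :=
  mderiv p (rep F p V) X
  + \sum_(i < k) \sum_(j < k) (mdiff F p X i 0 * V p j 0) *: G (F p) i j.

Definition levi_civita (R : realType) (bd : bool) (m : nat)
    (M : manifold R bd m) (g : M -> 'M[R]_m) (G : connection M) : Prop :=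
  forall (U : set M) X Y Z, open U ->
    smooth_field U X -> smooth_field U Y -> smooth_field U Z ->
    forall p, U p ->
      cov G id p (X p) Y - cov G id p (Y p) X = bracket X Y p /\
      mderiv p (fun x => inner g x (Y x) (Z x)) (X p) =
        inner g p (cov G id p (X p) Y) (Z p)
        + inner g p (Y p) (cov G id p (X p) Z).

Definition totally_geodesic (R : realType) (bd bd' : bool) (m k : nat)
    (P : manifold R bd m) (N : manifold R bd' k) (G : connection N)
    (F : P -> N) : Prop :=
  forall (U : set P) (Y : P -> 'cV[R]_m), open U -> smooth_field U Y ->
    forall p X, U p ->
      exists Z, cov G F p X (fun x => mdiff F x (Y x)) = mdiff F p Z.

Definition normal_to (R : realType) (bd bd' : bool) (m k : nat)
    (M : manifold R bd m) (N : manifold R bd' k) (g : N -> 'M[R]_k)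
    (F : M -> N) (p : M) (xi : 'cV[R]_k) : Prop :=
  forall X, inner g (F p) xi (mdiff F p X) = 0.

Definition pullback (R : realType) (bd bd' : bool) (m k : nat)
    (M : manifold R bd m) (N : manifold R bd' k) (g : N -> 'M[R]_k)
    (F : M -> N) (p : M) (X Y : 'cV[R]_m) : R :=
  inner g (F p) (mdiff F p X) (mdiff F p Y).

Definition normal_frame (R : realType) (bd bd' : bool) (m k q : nat)
    (M : manifold R bd m) (N : manifold R bd' k) (g : N -> 'M[R]_k)
    (F : M -> N) (nu : 'I_q -> M -> 'cV[R]_k) : Prop :=
  forall p,
    [/\ forall a, normal_to g F p (nu a p),
        forall a b, inner g (F p) (nu a p) (nu b p) = (a == b)%:R &
        forall xi, normal_to g F p xi ->
          exists c : 'I_q -> R, xi = \sum_(a < q) c a *: nu a p].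

Definition shape_operators (R : realType) (bd bd' : bool) (m k q : nat)
    (M : manifold R bd m) (N : manifold R bd' k) (g : N -> 'M[R]_k)
    (G : connection N) (F : M -> N) (nu : 'I_q -> M -> 'cV[R]_k)
    (A : 'I_q -> M -> 'M[R]_m) : Prop :=
  forall (U : set M) (Y : M -> 'cV[R]_m), open U -> smooth_field U Y ->
    forall a p X, U p ->
      pullback g F p (A a p *m X) (Y p) =
        inner g (F p) (cov G F p X (fun x => mdiff F x (Y x))) (nu a p).

(* eta is a smooth unit normal field of the hypersurface j : S -> P, for the
   metric induced on P by iota. *)
Definition unit_normal_field (R : realType) (bd bd' bd'' : bool) (l m k : nat)
    (S : manifold R bd l) (P : manifold R bd' m) (N : manifold R bd'' k)
    (g : N -> 'M[R]_k) (iota : P -> N) (j : S -> P) (eta : S -> 'cV[R]_m)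
    : Prop :=
  [/\ smooth_along j setT eta,
      forall s, pullback g iota (j s) (eta s) (eta s) = 1 &
      forall s X, pullback g iota (j s) (eta s) (mdiff j s X) = 0].

Definition positive_newton (R : realType) (bd bd' : bool) (m k q : nat)
    (M : manifold R bd m) (N : manifold R bd' k) (g : N -> 'M[R]_k)
    (F : M -> N) (A : 'I_q -> M -> 'M[R]_m) (u : mpoly.multinom q) : Prop :=
  forall p X, X != 0 ->
    0 < pullback g F p (newtonT (fun a => A a p) u *m X) X.

(* f : M -> S restricts to the identification of the boundary of M with S. *)
Definition transversal_along_boundary (R : realType) (bd bd' bd'' bd3 : bool)
    (l n m k q : nat) (M : manifold R bd n) (S : manifold R bd' l)
    (P : manifold R bd'' m) (N : manifold R bd3 k) (g : N -> 'M[R]_k)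
    (Psi : M -> N) (iota : P -> N) (j : S -> P) (f : M -> S)
    (eta : S -> 'cV[R]_m) (nu : 'I_q -> M -> 'cV[R]_k) : Prop :=
  forall p, mboundary M p ->
    exists a, inner g (Psi p) (mdiff iota (j (f p)) (eta (f p))) (nu a p) != 0.

(* Main.v *)
Require Import Defs.
From HB Require Import structures.
From mathcomp Require Import all_boot all_order all_algebra.
From mathcomp Require Import all_classical all_reals all_analysis.
From mathcomp Require mpoly.
Set Implicit Arguments.
Unset Strict Implicit.
Unset Printing Implicit Defensive.
Import Order.TTheory GRing.Theory Num.Theory.
Import numFieldNormedType.Exports.
Local Open Scope classical_set_scope.
Local Open Scope ring_scope.

(** The proof is by contradiction. Suppose that at a boundary point p the unit
    normal eta of Sigma in P is orthogonal to every normal vector of M, that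
    is, tangent to M. Near p write Sigma as a submanifold of M through the
    inverse e of f, and as a submanifold of P through j, so that Psi o e and
    iota o j are the same map into the ambient space. Then T_pM and T_pP are
    both spanned by T_pSigma and eta, hence they coincide.

    For a, b tangent to Sigma the second derivative of that common map can be
    computed through M or through P. By the Gauss formula for composites
    ([cov_comp]) both results are a second fundamental form evaluated at (a, b)
    up to a tangent vector of M, respectively of P; and P is totally geodesic.
    So the second fundamental form of M at (a, b) is tangent to P, thus to M,
    thus zero: <A_alpha a, b> = 0 for all a, b tangent to Sigma
    ([cov_tangent]).

    The rest is linear algebra ([newtonT_conormal]). By its recursion, T_u is
    the coefficient of t^u in the adjugate of I + sum_alpha t_alpha A_alpha.
    In the decomposition of T_pM into the line of eta and the hyperplane
    T_pSigma, the entry of the adjugate at (eta, eta) is the minor of the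
    block on T_pSigma. This block is the identity, so the minor is the constant
    1 and <T_u eta, eta> = 0 as soon as |u| >= 1, against positivity.

    The analytic part makes this rigorous at the boundary of M, where partial
    derivatives are one-sided: a map smooth on the half-space is replaced there
    by a smooth extension G to an open set, and the one-sided derivatives are
    the ordinary derivatives of G ([pderiv_within]). The totally geodesic
    condition and the shape operators are specified through smooth vector
    fields, so a tangent vector is extended to the field with constant
    components in a fixed chart ([const_field]), whose smoothness rests on the
    stability of [Ck] under composition ([Ck_comp]). *)

(** * Newton transformations and adjugates *)

Section NewtonAlgebra.

(* Imported locally: mpoly.mderiv would hide the derivative on manifolds. *)
Import -(notations) mpoly.

Definition pencil (R : realType) (n q : nat) (A : 'I_q -> 'M[R]_n) :
    'M[mpoly q R]_n :=
  1%:M + \sum_(a < q) mpolyX R (mnm1 a) *: map_mx (@mpolyC q R) (A a).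

Lemma sigmaE (R : realType) (n q : nat) (A : 'I_q -> 'M[R]_n)
    (u : multinom q) : sigma A u = mcoeff u (\det (pencil A)).
Proof. by []. Qed.

Lemma mcoeffMX1 (R : realType) (q : nat) (p : mpoly q R) (a : 'I_q)
    (u : multinom q) :
  mcoeff u (mpolyX R (mnm1 a) * p) =
  if (0 < fun_of_multinom u a)%N then mcoeff (mnm_sub u (mnm1 a)) p else 0.
Proof.
rewrite mulrC; case: ifPn => [ua|].
  have le1u : lem (mnm1 a) u by rewrite lep1mP -lt0n.
  by rewrite -{1}(submK le1u) addmC mcoeffMX.
rewrite -eqn0Ngt => /eqP ua.
apply/eqP; rewrite mcoeff_eq0; apply/negP.
rewrite (perm_mem (msuppMX _ _)) => /mapP[v _ uv].
by move: ua; rewrite uv mnmDE mnm1E eqxx.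
Qed.

Lemma mcoeff_gen_mul (R : realType) (n q : nat) (A : 'I_q -> 'M[R]_n)
    (B : 'M[mpoly q R]_n) (u : multinom q) :
  map_mx (mcoeff u) (pencil A *m B) = map_mx (mcoeff u) B
  + \sum_(a < q | (0 < fun_of_multinom u a)%N)
      A a *m map_mx (mcoeff (mnm_sub u (mnm1 a))) B.
Proof.
rewrite mulmxDl mul1mx map_mxD; congr (_ + _).
apply/matrixP => i k; rewrite mxE.
rewrite mulmx_suml !summxE raddf_sum /= [RHS]big_mkcond /=.
apply: eq_bigr => a _; rewrite -scalemxAl mxE mcoeffMX1; case: ifP => // _.
rewrite mxE [RHS]mxE raddf_sum; apply: eq_bigr => l _.
by rewrite !mxE /= mcoeffCM.
Qed.

Lemma pencil_coeff0 (R : realType) (n q : nat) (A : 'I_q -> 'M[R]_n) :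
  map_mx (mcoeff mnm0) (pencil A) = 1%:M.
Proof.
rewrite -[pencil A]mulmx1 mcoeff_gen_mul big1 ?addr0; last first.
  by move=> a; rewrite mnm0E.
by rewrite map_mx1.
Qed.

Lemma mdeg_sub1 (q : nat) (u : multinom q) (a : 'I_q) :
  (0 < fun_of_multinom u a)%N -> (mdeg (mnm_sub u (mnm1 a)) < mdeg u)%N.
Proof.
move=> ua; have le1u : lem (mnm1 a) u by rewrite lep1mP -lt0n.
by rewrite -{2}(submK le1u) mdegD mdeg1 addn1.
Qed.

(** Comparing coefficients in (I + tA) adj(I + tA) = det(I + tA) I gives
    exactly the recursion that defines T_u. *)
Lemma newtonT_adj (R : realType) (n q : nat) (A : 'I_q -> 'M[R]_n)
    (u : multinom q) :
  newtonT A u = map_mx (mcoeff u) (\adj (pencil A)).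
Proof.
elim: {u}_.+1 {-2}u (ltnSn (mdeg u)) => // k IHk u; rewrite ltnS => uk.
have [u0|u_gt0] := posnP (mdeg u).
  move/eqP: u0; rewrite mdeg_eq0 => /eqP ->.
  rewrite newtonT0 map_mx_adj pencil_coeff0.
  by have := mul_mx_adj (1%:M : 'M[R]_n); rewrite mul1mx det1.
rewrite newtonTE //; apply/eqP; rewrite subr_eq.
have <- : \sum_(a < q | (0 < fun_of_multinom u a)%N)
      A a *m map_mx (mcoeff (mnm_sub u (mnm1 a))) (\adj (pencil A)) =
   \sum_(a < q | (0 < fun_of_multinom u a)%N)
      A a *m newtonT A (mnm_sub u (mnm1 a)).
  apply: eq_bigr => a ua; rewrite IHk //.
  exact: leq_trans (mdeg_sub1 ua) uk.
rewrite -mcoeff_gen_mul mul_mx_adj; apply/eqP/matrixP => i j.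
by rewrite !mxE raddfMn.
Qed.

Lemma pencil_conj (R : realType) (n q : nat) (A B : 'I_q -> 'M[R]_n)
    (Q : 'M[R]_n) : (forall a, A a *m Q = Q *m B a) ->
  pencil A *m map_mx (@mpolyC q R) Q = map_mx (@mpolyC q R) Q *m pencil B.
Proof.
move=> AQ; rewrite mulmxDl mulmxDr mul1mx mulmx1 mulmx_suml mulmx_sumr.
congr (_ + _); apply: eq_bigr => a _.
by rewrite -scalemxAl -scalemxAr -!map_mxM AQ.
Qed.

(** Newton transformations do not depend on the basis, so they may be computed
    in a basis adapted to a hyperplane. *)
Lemma newtonT_conj (R : realType) (n q : nat) (A B : 'I_q -> 'M[R]_n)
    (Q : 'M[R]_n) (u : multinom q) : Q \in unitmx ->
  (forall a, A a *m Q = Q *m B a) -> newtonT A u *m Q = Q *m newtonT B u.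
Proof.
move=> Qu AQ.
have sAB v : sigma A v = sigma B v.
  rewrite (sigmaE A) (sigmaE B).
  suff -> : \det (pencil A) = \det (pencil B) by [].
  have := congr1 determinant (pencil_conj AQ).
  rewrite !det_mulmx mulrC; apply: mulfI.
  by rewrite det_map_mx /= mpolyC_eq0 -unitfE -unitmxE.
elim: {u}_.+1 {-2}u (ltnSn (mdeg u)) => // k IHk u; rewrite ltnS => uk.
have [u0|u_gt0] := posnP (mdeg u).
  move/eqP: u0; rewrite mdeg_eq0 => /eqP ->.
  by rewrite !newtonT0 mul1mx mulmx1.
rewrite !newtonTE // sAB mulmxBl mulmxBr scalar_mxC; congr (_ - _).
rewrite mulmx_suml mulmx_sumr; apply: eq_bigr => a ua.
rewrite -mulmxA IHk ?mulmxA ?AQ //.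
exact: leq_trans (mdeg_sub1 ua) uk.
Qed.

(** The (i0, i0) entry of the adjugate of I + tA is the minor that omits row
    and column i0, which is the determinant of an identity matrix here. *)
Lemma newtonT_corner (R : realType) (n q : nat) (A : 'I_q -> 'M[R]_n)
    (i0 : 'I_n) (u : multinom q) : (0 < mdeg u)%N ->
  (forall a i k, i != i0 -> k != i0 -> A a i k = 0) ->
  newtonT A u i0 i0 = 0.
Proof.
move=> u_gt0 A0; rewrite newtonT_adj !mxE /cofactor addnn -signr_odd odd_double.
rewrite mul1r.
have -> : row' i0 (col' i0 (pencil A)) = 1%:M.
  apply/matrixP => i k; rewrite !mxE summxE big1 ?addr0.
    by rewrite (inj_eq lift_inj).
  by move=> a _; rewrite !mxE A0 ?mpolyC0 ?mulr0 // eq_sym neq_lift.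
by rewrite det1 mcoeff1 -mdeg_eq0 eqn0Ngt u_gt0.
Qed.

End NewtonAlgebra.

(** * Differential calculus of C^r maps *)

Lemma open_near (T : topologicalType) (V : set T) (P : T -> Prop) (x : T) :
  open V -> V x -> (forall y, V y -> P y) -> \forall y \near x, P y.
Proof. by move=> oV Vx VP; exact: filterS VP (open_nbhs_nbhs (conj oV Vx)). Qed.

(** Differentials are local: a map that is only known near a point, such as a
    chart expression, may be replaced there by a global extension. *)
Lemma near_eq_diff (R : realType) (V W : normedModType R) (f g : V -> W)
    (x : V) : (\forall y \near x, f y = g y) -> differentiable f x ->
  differentiable g x /\ 'd g x = 'd f x :> (V -> W).
Proof.
move=> fg df.
have dgE : g \o shift x = cst (g x) + 'd f x +o_ 0 id.
  apply/eqaddoP => e e0.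
  have /eqaddoP/(_ e e0) := diff_locally df.
  have : \forall y \near (0 : V), f (y + x) = g (y + x).
    by move: fg; rewrite (near_shift 0) /= => fg; near=> y; near: y;
      apply: filterS fg => y /=; rewrite subr0.
  move=> fg0; apply: filterS2 fg0 => y /= fgy.
  by rewrite !fctE /= fgy (nbhs_singleton fg).
have E : 'd g x = 'd f x :> (V -> W).
  by apply: diff_unique => //; exact: diff_continuous.
split=> //; apply/diff_locallyP; rewrite E; split=> //.
exact: diff_continuous.
Unshelve. all: by end_near. Qed.

Lemma scale_is_bilinear (R : realType) (W : normedModType R) :
  bilinear_for (GRing.Scale.Law.clone _ _ *:%R _)
    (GRing.Scale.Law.clone _ _ *:%R _) (@GRing.scale R W).
Proof.
split=> [u'|u] a x y /=.
- by rewrite scalerDl scalerA.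
- by rewrite scalerDr !scalerA mulrC.
Qed.
HB.instance Definition _ (R : realType) (W : normedModType R) :=
  bilinear_isBilinear.Build R R W W _ _ (@GRing.scale R W)
    (@scale_is_bilinear R W).

Lemma differentiable_scale (R : realType) (V W : normedModType R)
    (k : V -> R) (h : V -> W) (x : V) :
  differentiable k x -> differentiable h x ->
  differentiable (fun z => k z *: h z) x.
Proof.
move=> dk dh; pose s p := @GRing.scale R W p.1 p.2.
apply: (@differentiable_comp _ _ _ _ (fun z => (k z, h z)) s).
  exact: differentiable_pair.
by apply: differentiable_bilin => p; exact: scale_continuous.
Qed.

Lemma diff_scale (R : realType) (V W : normedModType R)
    (k : V -> R) (h : V -> W) (x v : V) :
  differentiable k x -> differentiable h x ->
  'd (fun z => k z *: h z) x v = k x *: 'd h x v + 'd k x v *: h x.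
Proof.
move=> dk dh; pose s p := @GRing.scale R W p.1 p.2.
rewrite -[fun z => _]/(s \o (fun z => (k z, h z))).
have sc : continuous s by move=> p; exact: scale_continuous.
rewrite diff_comp; last 2 first.
- exact: differentiable_pair.
- exact: differentiable_bilin.
by rewrite /= diff_bilin // diff_pair.
Qed.

Lemma diff_basis (R : realType) (m : nat) (W : normedModType R)
    (G : 'cV[R]_m -> W) (x v : 'cV[R]_m) : differentiable G x ->
  'd G x v = \sum_(i < m) v i 0 *: 'D_(delta_mx i 0) G x.
Proof.
move=> dG; rewrite {1}[v]matrix_sum_delta linear_sum; apply: eq_bigr => i _.
by rewrite big_ord1 linearZ deriveE.
Qed.

Lemma Ck_subset (R : realType) (r m : nat) (W : normedModType R)
    (V V' : set 'cV[R]_m) (G : 'cV[R]_m -> W) :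
  V' `<=` V -> Ck r V G -> Ck r V' G.
Proof.
elim: r G => [|r IHr] G V'V /=; first by move=> cG x /V'V/cG.
by move=> [dG CG]; split=> [x /V'V/dG//|i]; apply: IHr.
Qed.

Lemma CkW (R : realType) (r m : nat) (W : normedModType R)
    (V : set 'cV[R]_m) (G : 'cV[R]_m -> W) : Ck r.+1 V G -> Ck r V G.
Proof.
elim: r G => [|r IHr] G [dG CG].
  by move=> x /dG; exact: differentiable_continuous.
by split=> // i; apply: IHr; apply: CG.
Qed.

Lemma Ck_eq (R : realType) (r m : nat) (W : normedModType R)
    (V : set 'cV[R]_m) (f g : 'cV[R]_m -> W) : open V ->
  (forall x, V x -> f x = g x) -> Ck r V f -> Ck r V g.
Proof.
move=> oV; elim: r f g => [|r IHr] f g fg.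
  move=> cf x Vx; rewrite /prop_for /continuous_at -(fg _ Vx).
  have gf : {near nbhs x, f =1 g}.
    by apply: (open_near oV Vx) => y Vy; rewrite fg.
  have fx := cf x Vx; have gx := near_eq_cvg gf.
  by move=> P fP; apply: gx; exact: fx.
have fgn x : V x -> \forall y \near x, f y = g y.
  by move=> Vx; exact: open_near oV Vx fg.
move=> [df Cf]; split=> [x Vx|i].
  exact: (near_eq_diff (fgn _ Vx) (df _ Vx)).1.
by apply: IHr (Cf i) => x Vx; apply: near_eq_derive; exact: fgn.
Qed.

Lemma Ck_cst (R : realType) (r m : nat) (W : normedModType R)
    (V : set 'cV[R]_m) (w : W) : open V -> Ck r V (cst w).
Proof.
move=> oV; elim: r w => [|r IHr] w; first by move=> x _; exact: cst_continuous.
split=> [x _|i]; first exact: differentiable_cst.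
by apply: Ck_eq oV _ (IHr 0) => x _; rewrite derive_cst.
Qed.

Lemma CkD (R : realType) (r m : nat) (W : normedModType R)
    (V : set 'cV[R]_m) (f g : 'cV[R]_m -> W) : open V ->
  Ck r V f -> Ck r V g -> Ck r V (fun x => f x + g x).
Proof.
move=> oV; elim: r f g => [|r IHr] f g.
  by move=> cf cg x Vx; apply: (@continuousD _ _ _ f g); [exact: cf|exact: cg].
move=> [df Cf] [dg Cg]; split=> [x Vx|i].
  by apply: differentiableD; [exact: df|exact: dg].
apply: Ck_eq oV _ (IHr _ _ (Cf i) (Cg i)) => x Vx.
by rewrite deriveD //; apply: diff_derivable; [exact: df|exact: dg].
Qed.

Lemma Ck_sum (R : realType) (r m k : nat) (W : normedModType R)
    (V : set 'cV[R]_m) (f : 'I_k -> 'cV[R]_m -> W) : open V ->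
  (forall j, Ck r V (f j)) -> Ck r V (fun x => \sum_(j < k) f j x).
Proof.
move=> oV; elim: k f => [|k IHk] f Cf.
  by apply: Ck_eq (Ck_cst r 0 oV) => // x _; rewrite big_ord0.
apply: Ck_eq (CkD oV (IHk _ (fun j => Cf (lift ord_max j))) (Cf ord_max)) => //.
move=> x _; rewrite big_ord_recr /=; congr (_ + _); apply: eq_bigr => i _.
by congr (f _ x); apply/val_inj; rewrite /= /bump leqNgt ltn_ord.
Qed.

Lemma Ck_scale (R : realType) (r m : nat) (W : normedModType R)
    (V : set 'cV[R]_m) (k : 'cV[R]_m -> R) (h : 'cV[R]_m -> W) : open V ->
  Ck r V k -> Ck r V h -> Ck r V (fun x => k x *: h x).
Proof.
move=> oV; elim: r k h => [|r IHr] k h.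
  by move=> ck ch x Vx; apply: (@continuousZ _ _ _ k h); [exact: ck|exact: ch].
move=> Ck1 Ch1; have [dk Ck'] := Ck1; have [dh Ch'] := Ch1; split=> [x Vx|i].
  by apply: differentiable_scale; [exact: dk|exact: dh].
apply: Ck_eq oV _
  (CkD oV (IHr _ _ (CkW Ck1) (Ch' i)) (IHr _ _ (Ck' i) (CkW Ch1))).
move=> x Vx; have dkx := dk x Vx; have dhx := dh x Vx.
by rewrite !deriveE ?diff_scale //; exact: differentiable_scale.
Qed.

Lemma Ck_coord (R : realType) (r m k : nat)
    (V : set 'cV[R]_m) (G : 'cV[R]_m -> 'cV[R]_k) (j : 'I_k) : open V ->
  Ck r V G -> Ck r V (fun x => G x j 0).
Proof.
move=> oV; elim: r G => [|r IHr] G.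
  move=> cG x Vx; apply: (@continuous_comp _ _ _ G (fun y : 'cV[R]_k => y j 0)).
    exact: cG.
  exact: coord_continuous.
move=> [dG CG]; split=> [x Vx|i].
  apply: (@differentiable_comp _ _ _ _ G (fun y : 'cV[R]_k => y j 0)).
    exact: dG.
  exact: differentiable_coord.
apply: Ck_eq oV _ (IHr _ (CG i)) => x Vx.
by rewrite derive_mx ?mxE //; apply: diff_derivable; exact: dG.
Qed.

(** By the chain rule the partial derivatives of H o G are sums of products of
    partial derivatives of G with partial derivatives of H composed with G;
    the latter are handled by induction on r. *)
Lemma Ck_comp (R : realType) (r m k : nat) (W : normedModType R)
    (V : set 'cV[R]_m) (V' : set 'cV[R]_k)
    (G : 'cV[R]_m -> 'cV[R]_k) (H : 'cV[R]_k -> W) : open V ->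
  (forall x, V x -> V' (G x)) -> Ck r V G -> Ck r V' H -> Ck r V (H \o G).
Proof.
move=> oV GV; elim: r G H GV => [|r IHr] G H GV.
  move=> cG cH x Vx; apply: continuous_comp; first exact: cG.
  by apply: cH; exact: GV.
move=> CG1 [dH CH]; have [dG CG] := CG1; split=> [x Vx|i].
  by apply: differentiable_comp; [exact: dG|apply: dH; exact: GV].
apply: Ck_eq oV _ (Ck_sum oV (fun j : 'I_k => Ck_scale oV
  (Ck_coord j oV (CG i)) (IHr _ _ GV (CkW CG1) (CH j)))) => x Vx /=.
have dGx := dG x Vx; have dHx := dH _ (GV _ Vx).
rewrite [RHS]deriveE; last exact: differentiable_comp.
rewrite diff_comp //= diff_basis //; apply: eq_bigr => j _.
by rewrite deriveE.
Qed.

Lemma Ck_diff (R : realType) (r m : nat) (W : normedModType R)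
    (V : set 'cV[R]_m) (G : 'cV[R]_m -> W) (v : 'cV[R]_m) : open V ->
  Ck r.+1 V G -> Ck r V (fun x => 'd G x v).
Proof.
move=> oV [dG CG]; apply: Ck_eq oV _
  (Ck_sum oV (fun i => Ck_scale oV (Ck_cst r (v i 0) oV) (CG i))).
by move=> x Vx; rewrite diff_basis //; exact: dG.
Qed.

Lemma diff_sum_scale (R : realType) (V W : normedModType R) (m : nat)
    (k : 'I_m -> V -> R) (h : 'I_m -> V -> W) (f : V -> W) (x v : V) :
  (\forall y \near x, \sum_(j < m) k j y *: h j y = f y) ->
  (forall j, differentiable (k j) x) -> (forall j, differentiable (h j) x) ->
  'd f x v = \sum_(j < m) (k j x *: 'd (h j) x v + 'd (k j) x v *: h j x).
Proof.
move=> nearf dk dh.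
have dkh j : differentiable (fun z => k j z *: h j z) x.
  exact: differentiable_scale.
pose S := \sum_(j < m) (fun z => k j z *: h j z).
have dS : differentiable S x by exact: differentiable_sum.
have nearS : \forall y \near x, S y = f y.
  by apply: filterS nearf => y; rewrite /S fct_sumE.
rewrite (near_eq_diff nearS dS).2 -deriveE // derive_sum => [|j]; last first.
  exact: diff_derivable.
apply: eq_bigr => j _.
exact: etrans (deriveE _ (dkh j)) (diff_scale v (dk j) (dh j)).
Qed.

(** The second-order chain rule, with the second derivative written as the
    derivative of z |-> dG_z(b). The first term becomes the second fundamental
    form of G, the last one is tangent to the image of G. It follows from the
    product rule applied to sum_j (dE_z(b))_j (d_j G)(E z). *)
Lemma diff2_comp (R : realType) (l m : nat) (W : normedModType R)
    (V : set 'cV[R]_l) (V' : set 'cV[R]_m)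
    (E : 'cV[R]_l -> 'cV[R]_m) (G : 'cV[R]_m -> W) (y a b : 'cV[R]_l) :
  open V -> V y -> open V' -> (forall x, V x -> V' (E x)) ->
  Ck 2 V E -> Ck 2 V' G ->
  'd (fun z => 'd (G \o E) z b) y a =
    'd (fun x => 'd G x ('d E y b)) (E y) ('d E y a)
    + 'd G (E y) ('d (fun z => 'd E z b) y a).
Proof.
move=> oV Vy oV' EV CE CG.
have dE z : V z -> differentiable E z by case: CE => dE _ /dE.
have dG x : V' x -> differentiable G x by case: CG => dG _ /dG.
have dDE : differentiable (fun z => 'd E z b) y.
  by have [dDE _] := Ck_diff b oV CE; exact: dDE.
have dDG j x : V' x -> differentiable ('D_(delta_mx j 0) G) x.
  by case: CG => _ /(_ j)[dDG _] /dDG.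
have dcoo j : differentiable (fun z => ('d E z b) j 0 : R) y.
  apply: (@differentiable_comp _ _ _ _ (fun z => 'd E z b)
    (fun y : 'cV[R]_m => y j 0)) => //; exact: differentiable_coord.
rewrite (@diff_sum_scale _ _ _ _ (fun j z => ('d E z b) j 0)
  (fun j => 'D_(delta_mx j 0) G \o E)) //; last 2 first.
- apply: (open_near oV Vy) => z Vz.
  have dEz := dE _ Vz; have dGz := dG _ (EV _ Vz).
  by rewrite [RHS](congr1 (@^~ b) (diff_comp dEz dGz)) /= (diff_basis _ dGz).
- by move=> j; apply: differentiable_comp; [exact: dE|apply: dDG; exact: EV].
rewrite (@diff_sum_scale _ _ _ _ (fun j => cst (('d E y b) j 0))
  (fun j => 'D_(delta_mx j 0) G)) //; last 2 first.
- apply: (open_near oV' (EV _ Vy)) => x Vx.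
  by rewrite (diff_basis _ (dG _ Vx)).
- by move=> j; apply: dDG; exact: EV.
rewrite (diff_basis ('d (fun z => 'd E z b) y a) (dG _ (EV _ Vy))).
rewrite -big_split /=; apply: eq_bigr => j _.
rewrite (diff_comp (dE _ Vy) (dDG j _ (EV _ Vy))).
rewrite diff_cst scale0r addr0 /=; congr (_ + _ *: _).
rewrite -deriveE // -[in RHS]deriveE // derive_mx ?mxE //.
exact: diff_derivable.
Qed.

(** * One-sided derivatives *)

(** Differentiability on a closed domain, encoded by a differentiable extension
    near the point. A Frechet derivative restricted to D would be an
    alternative, but with an extension the usual chain rule applies verbatim,
    and smooth maps on a half-space come with one. *)
Definition within_deriv (R : realType) (m : nat) (W : normedModType R)
    (D : set 'cV[R]_m) (f : 'cV[R]_m -> W) (x : 'cV[R]_m)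
    (L : 'cV[R]_m -> W) : Prop :=
  exists G : 'cV[R]_m -> W,
    [/\ differentiable G x, (\forall y \near x, D y -> f y = G y) &
        'd G x = L :> ('cV[R]_m -> W)].

(** At a boundary point of the half-space increments t >= 0 along every
    coordinate direction stay inside, so one-sided limits are not vacuous. *)
Lemma model_ray (R : realType) (bd : bool) (m : nat) (x : 'cV[R]_m) (i : 'I_m)
    (t : R) : model R bd m x -> 0 <= t ->
  model R bd m (x + t *: delta_mx i 0).
Proof.
move=> Dx t0 /= bdT k k0; rewrite !mxE addr_ge0 ?Dx //.
by rewrite mulr_ge0 // ler0n.
Qed.

Lemma pderiv_within (R : realType) (bd : bool) (m : nat) (W : normedModType R)
    (f : 'cV[R]_m -> W) (x : 'cV[R]_m) (L : 'cV[R]_m -> W) (i : 'I_m) :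
  model R bd m x -> within_deriv (model R bd m) f x L ->
  pderiv (model R bd m) f x i = L (delta_mx i 0).
Proof.
move=> Dx [G [dG fG <-]]; rewrite /pderiv -deriveE //.
set S := [set t : R | _].
have PF : ProperFilter (within S (0 : R)^').
  apply: Build_ProperFilter_ex => P.
  rewrite /within /= => /nbhs_ballP[e /= e0 eP].
  exists (e / 2); apply: eP => /=.
  - rewrite -ball_normE /= sub0r normrN gtr0_norm ?divr_gt0 //.
    by rewrite ltr_pdivrMr // ltr_pMr // ltr1n.
  - by rewrite gt_eqF // divr_gt0.
  - by apply: model_ray => //; rewrite divr_ge0 // ltW.
apply: cvg_lim => //.
have dD : (fun t : R => t^-1 *: ((G \o shift x) (t *: delta_mx i 0) - G x))
    @ (0 : R)^' --> 'D_(delta_mx i 0) G x by exact: diff_derivable.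
have cG : (fun t : R => t^-1 *: ((G \o shift x) (t *: delta_mx i 0) - G x))
    @ within S (0 : R)^' --> 'D_(delta_mx i 0) G x.
  apply: cvg_trans dD => P; rewrite /within /nbhs /= => nP.
  by apply: filterS nP => t Pt _.
apply: cvg_trans cG; apply: near_eq_cvg.
rewrite near_withinE.
have cx : (x + t *: delta_mx i 0) @[t --> (0 : R)^'] --> x.
  rewrite -[X in _ --> X]addr0; apply: cvgD; first exact: cvg_cst.
  rewrite -[X in _ --> X](scale0r (delta_mx i 0 : 'cV[R]_m)).
  by apply: cvgZr_tmp => P; exact: nbhs_dnbhs.
have fGt : \forall t \near (0 : R)^',
    model R bd m (x + t *: delta_mx i 0) ->
    f (x + t *: delta_mx i 0) = G (x + t *: delta_mx i 0) by exact: cx _ fG.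
apply: filterS fGt => t /= fGt St.
by rewrite [t *: _ + x]addrC fGt // (nbhs_singleton fG).
Qed.

Lemma within_deriv_sum (R : realType) (bd : bool) (m : nat)
    (W : normedModType R) (f : 'cV[R]_m -> W) (x X : 'cV[R]_m)
    (L : 'cV[R]_m -> W) :
  model R bd m x -> within_deriv (model R bd m) f x L ->
  \sum_(i < m) X i 0 *: pderiv (model R bd m) f x i = L X.
Proof.
move=> Dx fL; under eq_bigr do rewrite (pderiv_within _ Dx fL).
have [G [dG _ <-]] := fL.
by rewrite diff_basis //; apply: eq_bigr => i _; rewrite deriveE.
Qed.

Lemma within_deriv_comp (R : realType) (m k : nat) (W : normedModType R)
    (D : set 'cV[R]_m) (D' : set 'cV[R]_k) (f : 'cV[R]_m -> 'cV[R]_k)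
    (h : 'cV[R]_k -> W) (x : 'cV[R]_m) (L : 'cV[R]_m -> 'cV[R]_k)
    (L' : 'cV[R]_k -> W) :
  D x -> (\forall y \near x, D y -> D' (f y)) ->
  within_deriv D f x L -> within_deriv D' h (f x) L' ->
  within_deriv D (h \o f) x (L' \o L).
Proof.
move=> Dx fD' [G [dG fG <-]] [H [dH hH <-]].
have fx : f x = G x by exact: (nbhs_singleton fG).
rewrite fx in dH hH *; exists (H \o G); split.
- exact: differentiable_comp.
- have hHG : \forall y \near x, D' (G y) -> h (G y) = H (G y).
    exact: differentiable_continuous dG _ hH.
  apply: filterS3 fG hHG fD' => y fGy hHGy fDy Dy /=.
  by rewrite fGy // hHGy // -fGy //; exact: fDy.
- by rewrite diff_comp.
Qed.

(** * Derivatives in charts *)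

Lemma atlas_chart (R : realType) (bd : bool) (m : nat) (M : manifold R bd m)
    (c : chart R m M) : atlas c -> is_chart bd c.
Proof. by case: M c => /= ? ? ? ? ? H ? ? ? c; exact: H. Qed.

Lemma atlas_compat (R : realType) (bd : bool) (m : nat) (M : manifold R bd m)
    (c d : chart R m M) : atlas c -> atlas d ->
  smooth_on (cmap c @` (cdom c `&` cdom d)) (cmap d \o cinv c).
Proof. by case: M c d => /= ? ? ? ? ? ? H ? ? c d; exact: H. Qed.

Lemma chart_at_atlas (R : realType) (bd : bool) (m : nat)
    (M : manifold R bd m) (p : M) : atlas (chart_at p).
Proof. by case: M p => /= ? ? ? ? ? ? ? H ? p; exact: H. Qed.

Lemma chart_at_dom (R : realType) (bd : bool) (m : nat)
    (M : manifold R bd m) (p : M) : cdom (chart_at p) p.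
Proof. by case: M p => /= ? ? ? ? ? ? ? ? H p; exact: H. Qed.

Lemma chart_open (R : realType) (bd : bool) (m : nat)
    (M : manifold R bd m) (c : chart R m M) : atlas c -> open (cdom c).
Proof. by move=> /atlas_chart[]. Qed.

Lemma cmapK (R : realType) (bd : bool) (m : nat)
    (M : manifold R bd m) (c : chart R m M) (x : M) : atlas c -> cdom c x ->
  cinv c (cmap c x) = x.
Proof. by move=> /atlas_chart[_ _ H _ _]; exact: H. Qed.

Lemma cmap_model (R : realType) (bd : bool) (m : nat)
    (M : manifold R bd m) (c : chart R m M) (x : M) : atlas c -> cdom c x ->
  model R bd m (cmap c x).
Proof.
move=> /atlas_chart[_ [V _ E] _ _ _] cx.
have : (cmap c @` cdom c) (cmap c x) by exists x.
by rewrite E => -[].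
Qed.

(** Charts have images that are only relatively open in the model, so a
    property that holds near x in M holds near the image of x at the points of
    the model. *)
Lemma chart_near (R : realType) (bd : bool) (m : nat)
    (M : manifold R bd m) (c : chart R m M) (x : M) (P : M -> Prop) :
  atlas c -> cdom c x -> (\forall y \near x, P y) ->
  \forall z \near cmap c x, model R bd m z ->
    [/\ cdom c (cinv c z), cmap c (cinv c z) = z & P (cinv c z)].
Proof.
move=> ac cx Px; have [_ [V oV VE] cK _ cinvc] := atlas_chart ac.
have imx : (cmap c @` cdom c) (cmap c x) by exists x.
have Vx : V (cmap c x) by move: imx; rewrite VE => -[].
have Px' : \forall y \near cinv c (cmap c x), P y by rewrite cK.
have nP : \forall z \near cmap c x, (cmap c @` cdom c) z -> P (cinv c z).
  by move/subspace_continuousP : cinvc => /(_ _ imx) /(_ _ Px').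
have nV : \forall z \near cmap c x, V z by exact: (open_near oV Vx).
apply: filterS2 nP nV => z zP Vz Dz.
have imz : (cmap c @` cdom c) z by rewrite VE.
have Pz := zP imz; have [y cy yz] := imz.
by move: Pz; rewrite -yz (cK _ cy).
Qed.

(** The chart c is a parameter: definitions by components use the chart selected
    at x, whereas derivatives of a field near p are taken in the chart selected
    at p. *)
Definition chart_deriv (R : realType) (bd : bool) (m : nat)
    (M : manifold R bd m) (W : normedModType R) (c : chart R m M)
    (h : M -> W) (x : M) (L : 'cV[R]_m -> W) : Prop :=
  within_deriv (model R bd m) (h \o cinv c) (cmap c x) L.

Lemma mderivE (R : realType) (bd : bool) (m : nat) (M : manifold R bd m)
    (W : normedModType R) (h : M -> W) (x : M) (L : 'cV[R]_m -> W)
    (X : 'cV[R]_m) :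
  chart_deriv (chart_at x) h x L -> mderiv x h X = L X.
Proof.
move=> hL; rewrite /mderiv (within_deriv_sum _ _ hL) //.
exact: cmap_model (chart_at_atlas x) (chart_at_dom x).
Qed.

Lemma chart_deriv_uniq (R : realType) (bd : bool) (m : nat)
    (M : manifold R bd m) (W : normedModType R) (c : chart R m M)
    (h : M -> W) (x : M) (L L' : 'cV[R]_m -> W) (X : 'cV[R]_m) :
  atlas c -> cdom c x ->
  chart_deriv c h x L -> chart_deriv c h x L' -> L X = L' X.
Proof.
move=> ac cx hL hL'; have Dx := cmap_model ac cx.
by rewrite -(within_deriv_sum X Dx hL) (within_deriv_sum X Dx hL').
Qed.

Lemma chart_deriv_comp (R : realType) (bd bd' : bool) (m k : nat)
    (M : manifold R bd m) (N : manifold R bd' k) (W : normedModType R)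
    (c : chart R m M) (d : chart R k N) (F : M -> N) (h : N -> W) (x : M)
    (L : 'cV[R]_m -> 'cV[R]_k) (L' : 'cV[R]_k -> W) :
  atlas c -> atlas d -> cdom c x -> (\forall y \near x, cdom d (F y)) ->
  chart_deriv c (cmap d \o F) x L -> chart_deriv d h (F x) L' ->
  chart_deriv c (h \o F) x (L' \o L).
Proof.
move=> ac ad cx dF FL hL; have Dx := cmap_model ac cx.
have dFn := chart_near ac cx dF.
have [||G [dG Gn GE]] := @within_deriv_comp R m k W (model R bd m)
  (model R bd' k) (cmap d \o F \o cinv c) (h \o cinv d) (cmap c x) L L' Dx _ FL.
- apply: filterS dFn => z zF Dz /=; have [_ _ dz] := zF Dz.
  exact: cmap_model ad dz.
- by rewrite /= cmapK.
exists G; split=> //; apply: filterS2 Gn dFn => z Gz zF Dz.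
have [_ _ dz] := zF Dz.
by rewrite -Gz //= cmapK.
Qed.

Lemma chart_deriv_id (R : realType) (bd : bool) (m : nat)
    (M : manifold R bd m) (c : chart R m M) (x : M) :
  atlas c -> cdom c x -> chart_deriv c (cmap c) x id.
Proof.
move=> ac cx; exists id; split=> //; last by rewrite diff_val.
have := @chart_near _ _ _ _ c x (fun=> True) ac cx.
by move=> /(_ filterT); apply: filterS => z zP Dz /=; have [_ ->] := zP Dz.
Qed.

Lemma smooth_on_ext (R : realType) (bd : bool) (m : nat)
    (M : manifold R bd m) (W : normedModType R) (c : chart R m M)
    (U : set M) (h : M -> W) (x : M) :
  atlas c -> open U -> U x -> cdom c x ->
  smooth_on (cmap c @` U) (h \o cinv c) ->
  exists (V : set 'cV[R]_m) (G : 'cV[R]_m -> W),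
    [/\ open V, V (cmap c x), (forall r, Ck r V G) &
        forall z, V z -> model R bd m z ->
          [/\ cdom c (cinv c z), cmap c (cinv c z) = z, U (cinv c z) &
              h (cinv c z) = G z]].
Proof.
move=> ac oU Ux cx hs.
have [|V [G [oV Vx CG hG]]] := hs (cmap c x); first by exists x.
have Un : \forall y \near x, U y by exact: (open_near oU Ux).
have := chart_near ac cx Un; set Q := (fun z => _) => nQ.
exists (V `&` Q°), G; split.
- by apply: openI => //; exact: open_interior.
- by split=> //; exact: nQ.
- by move=> r; apply: Ck_subset (CG r) => z [].
- move=> z [Vz /nbhs_singleton Qz] Dz; have [cz zK Uz] := Qz Dz.
  by split=> //; apply: hG => //; exists (cinv c z).
Qed.

Lemma chart_deriv_ext (R : realType) (bd : bool) (m : nat)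
    (M : manifold R bd m) (W : normedModType R) (c : chart R m M)
    (h : M -> W) (x : M) (V : set 'cV[R]_m) (G : 'cV[R]_m -> W) :
  open V -> V (cmap c x) -> (forall r, Ck r V G) ->
  (forall z, V z -> model R bd m z -> h (cinv c z) = G z) ->
  chart_deriv c h x ('d G (cmap c x)).
Proof.
move=> oV Vx CG hG; exists G; split=> //.
  by have [dG _] := CG 1%N; exact: dG.
by apply: (open_near oV Vx) => z Vz Dz; exact: hG.
Qed.

Lemma chart_change_deriv (R : realType) (bd : bool) (m : nat)
    (M : manifold R bd m) (c d : chart R m M) (x : M) :
  atlas c -> atlas d -> cdom c x -> cdom d x ->
  exists L, chart_deriv c (cmap d) x L.
Proof.
move=> ac ad cx dx.
have [||V [G [oV Vx CG hG]]] := smooth_on_ext ac _ _ cx (atlas_compat ac ad).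
- by apply: openI; exact: chart_open.
- by [].
exists ('d G (cmap c x)); apply: (chart_deriv_ext oV) => // z Vz Dz.
by have [] := hG _ Vz Dz.
Qed.

(** * Vector fields with constant components and covariant derivatives *)

(** The vector field near p with constant components v in the chart selected at
    p: its value at x must be given in the chart selected at x, hence the
    derivative of the change of charts. *)
Definition const_field (R : realType) (bd : bool) (m : nat)
    (M : manifold R bd m) (p : M) (v : 'cV[R]_m) (x : M) : 'cV[R]_m :=
  \sum_(i < m) v i 0 *: pderiv (model R bd m)
    (cmap (chart_at x) \o cinv (chart_at p)) (cmap (chart_at p) x) i.

Lemma mderiv_const_field (R : realType) (bd : bool) (m : nat)
    (M : manifold R bd m) (W : normedModType R) (p x : M) (v : 'cV[R]_m)
    (h : M -> W) (L : 'cV[R]_m -> W) :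
  cdom (chart_at p) x -> chart_deriv (chart_at p) h x L ->
  mderiv x h (const_field p v x) = L v.
Proof.
move=> px hL; have [ap ax] := (chart_at_atlas p, chart_at_atlas x).
have xx := chart_at_dom x.
have [K xK] := chart_change_deriv ap ax px xx.
have [K' pK] := chart_change_deriv ax ap xx px.
have nx : \forall y \near x, cdom (chart_at x) y.
  by exact: (open_near (chart_open ax) xx).
have np : \forall y \near x, cdom (chart_at p) y.
  by exact: (open_near (chart_open ap) px).
have -> : const_field p v x = K v.
  exact: within_deriv_sum (cmap_model ap px) xK.
rewrite (mderivE _ (chart_deriv_comp (F := id) ax ap xx np pK hL)) /=.
have pKK := chart_deriv_comp (F := id) ap ax px nx xK pK.
congr L; exact: chart_deriv_uniq v ap px pKK (chart_deriv_id ap px).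
Qed.

Lemma const_field_at (R : realType) (bd : bool) (m : nat)
    (M : manifold R bd m) (p : M) (v : 'cV[R]_m) : const_field p v p = v.
Proof.
have [ap pp] := (chart_at_atlas p, chart_at_dom p).
exact: within_deriv_sum (cmap_model ap pp) (chart_deriv_id ap pp).
Qed.

(** In the chart at p' the field is z |-> d(tau^-1)_(tau z)(v), with tau the
    change from the chart at p' to the chart at p. *)
Lemma const_field_smooth (R : realType) (bd : bool) (m : nat)
    (M : manifold R bd m) (p : M) (v : 'cV[R]_m) :
  smooth_field (cdom (chart_at p)) (const_field p v).
Proof.
move=> p' pp'; have [ap ap'] := (chart_at_atlas p, chart_at_atlas p').
have [op op'] := (chart_open ap, chart_open ap').
exists (cdom (chart_at p) `&` cdom (chart_at p')); split.
- exact: openI.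
- by split=> //; exact: chart_at_dom.
- by move=> y [].
move=> _ [x [[px p'x] _] <-].
have [||V1 [G1 [oV1 V1x CG1 hG1]]] :=
  smooth_on_ext ap' _ _ p'x (atlas_compat ap' ap); [exact: openI|by []|].
have [||V2 [G2 [oV2 V2x CG2 hG2]]] :=
  smooth_on_ext ap _ _ px (atlas_compat ap ap'); [exact: openI|by []|].
have G1x : cmap (chart_at p) x = G1 (cmap (chart_at p') x).
  have [_ _ _ <-] := hG1 _ V1x (cmap_model ap' p'x).
  by rewrite cmapK.
pose V := (V1 `&` G1 @^-1` V2)°.
have V12 : V `<=` V1 `&` G1 @^-1` V2 by exact: interior_subset.
exists V, (fun z => 'd G2 (G1 z) v); split.
- exact: open_interior.
- have nV1 : \forall z \near cmap (chart_at p') x, V1 z.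
    by exact: (open_near oV1 V1x).
  have nV2 : \forall z \near G1 (cmap (chart_at p') x), V2 z.
    by apply: (open_near oV2) => //; rewrite -G1x.
  have cG1 := CG1 0%N _ V1x.
  have nG : \forall z \near cmap (chart_at p') x, V2 (G1 z) by exact: cG1 _ nV2.
  by apply: filterS2 nV1 nG => z; split.
- move=> r; apply: (@Ck_comp _ r _ _ _ V V2 G1 (fun y => 'd G2 y v)).
  + exact: open_interior.
  + by move=> z /V12[].
  + by apply: Ck_subset (CG1 r) => z /V12[].
  + exact: Ck_diff.
move=> _ [y [[py p'y] _] <-] /V12[V1y V2y].
rewrite /= cmapK // /rep /=.
have yG1 : cmap (chart_at p) y = G1 (cmap (chart_at p') y).
  have [_ _ _ <-] := hG1 _ V1y (cmap_model ap' p'y).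
  by rewrite cmapK.
rewrite -yG1; apply: mderiv_const_field => //.
apply: (@chart_deriv_ext _ _ _ _ _ _ _ _ V2) => //.
  by rewrite yG1.
by move=> z Vz Dz; have [] := hG2 _ Vz Dz.
Qed.

(** G is a smooth extension, to an open set of the vector space, of the
    expression of F in the charts selected at p and at F p. Such an extension
    can be differentiated as usual even when p is a boundary point. *)
Definition local_rep (R : realType) (bd bd' : bool) (m k : nat)
    (M : manifold R bd m) (N : manifold R bd' k) (F : M -> N) (p : M)
    (V : set 'cV[R]_m) (G : 'cV[R]_m -> 'cV[R]_k) : Prop :=
  [/\ open V, V (cmap (chart_at p) p), (forall r, Ck r V G) &
      forall z, V z -> model R bd m z ->
        [/\ cdom (chart_at p) (cinv (chart_at p) z),
            cmap (chart_at p) (cinv (chart_at p) z) = z,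
            cdom (chart_at (F p)) (F (cinv (chart_at p) z)) &
            cmap (chart_at (F p)) (F (cinv (chart_at p) z)) = G z]].

Lemma smooth_map_local_rep (R : realType) (bd bd' : bool) (m k : nat)
    (M : manifold R bd m) (N : manifold R bd' k) (F : M -> N) (p : M) :
  smooth_map setT F -> exists V G, local_rep F p V G.
Proof.
move=> /(_ p I)[[U [oU Up UF]] [U' [oU' Up' U'c hs]]].
have [ap pp] := (chart_at_atlas p, chart_at_dom p).
have nU : \forall y \near p, U y by exact: (open_near oU Up).
rewrite setIT in hs.
have [V [G [oV Vp CG hG]]] := smooth_on_ext ap oU' Up' pp hs.
have := chart_near ap pp nU; set Q := (fun z => _) => nQ.
exists (V `&` Q°), G; split.
- by apply: openI => //; exact: open_interior.
- by split=> //; exact: nQ.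
- by move=> r; apply: Ck_subset (CG r) => z [].
- move=> z [Vz /nbhs_singleton Qz] Dz; have [cz zK Uz] := Qz Dz.
  by split=> //; [exact: UF|have [] := hG _ Vz Dz].
Qed.

Lemma local_rep_deriv (R : realType) (bd bd' : bool) (m k : nat)
    (M : manifold R bd m) (N : manifold R bd' k) (F : M -> N) (p x : M)
    (V : set 'cV[R]_m) (G : 'cV[R]_m -> 'cV[R]_k) :
  local_rep F p V G -> V (cmap (chart_at p) x) ->
  chart_deriv (chart_at p) (cmap (chart_at (F p)) \o F) x
    ('d G (cmap (chart_at p) x)).
Proof.
move=> [oV _ CG hG] Vx; apply: (chart_deriv_ext oV) => // z Vz Dz.
by have [] := hG _ Vz Dz.
Qed.

Lemma mdiff_local_rep (R : realType) (bd bd' : bool) (m k : nat)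
    (M : manifold R bd m) (N : manifold R bd' k) (F : M -> N) (p : M)
    (V : set 'cV[R]_m) (G : 'cV[R]_m -> 'cV[R]_k) (X : 'cV[R]_m) :
  local_rep F p V G -> mdiff F p X = 'd G (cmap (chart_at p) p) X.
Proof.
move=> FG; apply: mderivE; apply: (local_rep_deriv FG).
by have [] := FG.
Qed.

(** The components of dF(X) in the single chart at F p are obtained by
    differentiating F in that chart, even though dF(X) is defined through the
    chart selected at F x, which varies with x. *)
Lemma rep_mdiff (R : realType) (bd bd' : bool) (m k : nat)
    (M : manifold R bd m) (N : manifold R bd' k) (F : M -> N) (p x : M)
    (X : 'cV[R]_m) : smooth_map setT F ->
  cdom (chart_at (F p)) (F x) ->
  mderiv (F x) (cmap (chart_at (F p))) (mdiff F x X) =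
  mderiv x (cmap (chart_at (F p)) \o F) X.
Proof.
move=> sF Fx; have [V [G FG]] := smooth_map_local_rep x sF.
have Vx : V (cmap (chart_at x) x) by have [] := FG.
have FL := local_rep_deriv FG Vx.
have [L FpL] := chart_change_deriv (chart_at_atlas (F x)) (chart_at_atlas (F p))
  (chart_at_dom (F x)) Fx.
have nF : \forall y \near x, cdom (chart_at (F x)) (F y).
  have [[U [oU Ux UF]] _] := sF x I.
  by apply: (open_near oU Ux) => y Uy; exact: UF.
have FFL := chart_deriv_comp (chart_at_atlas x) (chart_at_atlas (F x))
  (chart_at_dom x) nF FL FpL.
by rewrite (mderivE _ FFL) (mderivE _ FpL) /= (mdiff_local_rep _ FG).
Qed.

(** In the fixed chart at F p the field dF(v) is z |-> dG_z(v) by [rep_mdiff]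
    and [mderiv_const_field], so its derivative is a second derivative of G
    and no derivative of the components v enters. *)
Lemma cov_const_field (R : realType) (bd bd' : bool) (m k : nat)
    (M : manifold R bd m) (N : manifold R bd' k) (Gam : connection N)
    (F : M -> N) (p : M) (V : set 'cV[R]_m) (G : 'cV[R]_m -> 'cV[R]_k)
    (X v : 'cV[R]_m) :
  smooth_map setT F -> local_rep F p V G ->
  cov Gam F p X (fun x => mdiff F x (const_field p v x)) =
    'd (fun z => 'd G z v) (cmap (chart_at p) p) X
    + \sum_(i < k) \sum_(j < k)
        (mdiff F p X i 0 * mdiff F p v j 0) *: Gam (F p) i j.
Proof.
move=> sF FG; rewrite /cov const_field_at; congr (_ + _).
apply: mderivE; have [oV Vp CG hG] := FG.
exists (fun z => 'd G z v); split=> //.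
  by have [+ _] := Ck_diff v oV (CG 2%N); apply.
apply: (open_near oV Vp) => z Vz Dz; have [cz zK Fz _] := hG _ Vz Dz.
have zV : V (cmap (chart_at p) (cinv (chart_at p) z)) by rewrite zK.
have FL := local_rep_deriv FG zV.
have E := mderiv_const_field v cz FL; rewrite zK in E.
rewrite -E; exact: rep_mdiff.
Qed.

(** * Newton transformations at a hyperplane *)

Lemma unitmx_inj (R : fieldType) (n : nat) (Q : 'M[R]_n) :
  (forall x : 'cV[R]_n, Q *m x = 0 -> x = 0) -> Q \in unitmx.
Proof.
move=> Qinj; rewrite -unitmx_tr -row_free_unit; apply: inj_row_free => x xQ.
apply: trmx_inj; rewrite trmx0; apply: Qinj.
by apply: trmx_inj; rewrite trmx_mul trmxK xQ trmx0.
Qed.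

Lemma row_mx_cV (R : fieldType) (n l : nat) (v : 'cV[R]_n) (H : 'M[R]_(n, l))
    (x : 'cV[R]_(1 + l)) :
  row_mx v H *m x = (usubmx x) 0 0 *: v + H *m dsubmx x.
Proof.
rewrite -{1}[x]vsubmxK mul_row_col; congr (_ + _).
by rewrite {1}[usubmx x]mx11_scalar mul_mx_scalar.
Qed.

(** A vector of nonzero length that is orthogonal to a hyperplane completes a
    basis of the hyperplane. *)
Lemma hyperplane_basis (R : realType) (n l : nat) (K : 'M[R]_n)
    (H : 'M[R]_(n, l)) (v : 'cV[R]_n) (x : 'cV[R]_(1 + l)) :
  (forall x : 'cV[R]_l, H *m x = 0 -> x = 0) ->
  v^T *m K *m v != 0 -> v^T *m K *m H = 0 ->
  row_mx v H *m x = 0 -> x = 0.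
Proof.
move=> Hinj vv vH; rewrite row_mx_cV => xQ.
have x1 : (usubmx x) 0 0 = 0.
  apply/eqP; have := congr1 (mulmx (v^T *m K)) xQ.
  rewrite mulmxDr mulmxA vH mul0mx addr0 -scalemxAr mulmx0 => /eqP.
  by rewrite scaler_eq0 (negPf vv) orbF.
move: xQ; rewrite x1 scale0r add0r => /Hinj x2.
rewrite -[x]vsubmxK x2 [usubmx x]mx11_scalar x1.
by rewrite raddf0 col_mx0.
Qed.

(** K is the metric, the columns of H span a hyperplane and v is orthogonal to
    it. If the compression of every A a to the hyperplane vanishes, then in the
    basis (v, H) the matrices A a have a zero block complementary to the entry
    of v, and the (v, v) entry of T_u is given by [newtonT_corner]. *)
Lemma newtonT_conormal (R : realType) (n l q : nat) (K : 'M[R]_n)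
    (H : 'M[R]_(n, l)) (v : 'cV[R]_n) (A : 'I_q -> 'M[R]_n)
    (u : mpoly.multinom q) :
  n = l.+1 -> K^T = K ->
  (forall x : 'cV[R]_n, x != 0 -> 0 < (x^T *m K *m x) 0 0) ->
  (forall x : 'cV[R]_l, H *m x = 0 -> x = 0) -> v != 0 -> v^T *m K *m H = 0 ->
  (forall a, (A a *m H)^T *m K *m H = 0) -> (0 < mpoly.mdeg u)%N ->
  ((newtonT A u *m v)^T *m K *m v) 0 0 = 0.
Proof.
move=> nl; move: K H v A; rewrite {}nl => K H v A Ksym Kpos Hinj v0 vH AH u0.
have Kpos0 (x : 'cV[R]_l.+1) : x^T *m K *m x = 0 -> x = 0.
  move=> xKx; apply/eqP; apply/negPn/negP => /(Kpos x).
  by rewrite xKx mxE ltxx.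
have vv : v^T *m K *m v != 0 by apply/eqP => /Kpos0 /eqP; rewrite (negPf v0).
pose Q : 'M[R]_l.+1 := row_mx v H.
have Qu : Q \in unitmx.
  by apply: unitmx_inj => x; exact: (hyperplane_basis Hinj vv vH).
pose B a := invmx Q *m A a *m Q.
have AQ a : A a *m Q = Q *m B a by rewrite /B !mulmxA mulmxV // mul1mx.
have Hv : H^T *m K *m v = 0.
  by apply: trmx_inj; rewrite !trmx_mul trmxK Ksym mulmxA vH !trmx0.
pose e0 : 'cV[R]_(1 + l) := delta_mx 0 0.
have Qe0 : Q *m e0 = v.
  rewrite /Q row_mx_cV /e0 mxE mxE eqxx scale1r.
  have -> : dsubmx (delta_mx 0 0 : 'cV[R]_(1 + l)) = 0.
    by apply/matrixP => i j; rewrite !mxE.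
  by rewrite mulmx0 addr0.
(* A a maps the hyperplane into the line of v: the component of A a (H x) in
   the hyperplane has zero length, being orthogonal to the hyperplane. *)
have B0 a i k : i != ord0 -> k != ord0 -> B a i k = 0.
  move=> i0 k0; pose w : 'cV[R]_(1 + l) := col k (B a).
  suff w2 : dsubmx w = 0.
    have [j ji] : exists j : 'I_l, i = rshift 1 j.
      case: (unliftP ord0 i) i0 => [j ->|->] // _.
      by exists j; apply/val_inj.
    by have := congr1 (fun M : 'cV_l => M j 0) w2; rewrite /w !mxE -ji.
  have [j kj] : exists j : 'I_l, k = rshift 1 j.
    case: (unliftP ord0 k) k0 => [j ->|->] // _.
    by exists j; apply/val_inj.
  have Qw : Q *m w = A a *m col j H.
    rewrite /w colE mulmxA -AQ -mulmxA -colE; congr (_ *m _).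
    by rewrite kj /Q; apply/matrixP => r c; rewrite [LHS]mxE [RHS]mxE;
      exact: row_mxEr.
  have HAH : H^T *m K *m (A a *m H) = 0.
    by apply: trmx_inj; rewrite trmx0 !trmx_mul trmxK Ksym mulmxA -trmx_mul AH.
  have : H^T *m K *m (H *m dsubmx w) = 0.
    have := congr1 (mulmx (H^T *m K)) Qw.
    rewrite /Q row_mx_cV mulmxDr -scalemxAr Hv scaler0 add0r => ->.
    by rewrite colE [A a *m _]mulmxA mulmxA HAH mul0mx.
  move=> /(congr1 (mulmx (dsubmx w)^T)); rewrite mulmx0 !mulmxA -trmx_mul.
  by rewrite -mulmxA => /Kpos0 /Hinj.
have QKv : Q^T *m (K *m v) = (v^T *m K *m v) 0 0 *: e0.
  rewrite [Q^T](tr_row_mx v H) (mul_col_mx v^T) !mulmxA Hv.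
  rewrite [v^T *m K *m v]mx11_scalar; apply/matrixP => i j.
  rewrite !mxE !eqxx ord1 mulr1n; case: splitP => k /= ik; rewrite !mxE.
    have -> : i = 0 by apply/val_inj; rewrite /= ik ord1.
    by rewrite !ord1 eqxx mulr1.
  have -> : (i == 0) = false by apply/eqP => i0; rewrite i0 in ik.
  by rewrite mulr0.
have Tv : newtonT A u *m v = Q *m (newtonT B u *m e0).
  by rewrite -{1}Qe0 [LHS]mulmxA (newtonT_conj u Qu AQ) mulmxA.
rewrite Tv trmx_mul -!mulmxA QKv -!scalemxAr mxE trmx_mul trmx_delta.
by rewrite -mulmxA -colE -rowE !mxE newtonT_corner ?mulr0.
Qed.

(** * The second derivative of a composite *)

(** Smoothness is decided by local expressions; the neighbourhood demanded by
    [smooth_map] comes from the continuity of the charts. *)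
Lemma local_rep_smooth (R : realType) (bd bd' : bool) (m k : nat)
    (M : manifold R bd m) (N : manifold R bd' k) (F : M -> N) :
  (forall p, exists V G, local_rep F p V G) -> smooth_map setT F.
Proof.
move=> FG p _; have [V [G [oV Vp CG hG]]] := FG p.
have [ap pp] := (chart_at_atlas p, chart_at_dom p).
pose U := [set x | cdom (chart_at p) x /\ V (cmap (chart_at p) x)]°.
have UV : U `<=` [set x | cdom (chart_at p) x /\ V (cmap (chart_at p) x)].
  exact: interior_subset.
have Up : U p.
  have [_ _ _ cmapc _] := atlas_chart ap.
  have nV : \forall z \near cmap (chart_at p) p, V z.
    by exact: (open_near oV Vp).
  have nVp : \forall x \near p, cdom (chart_at p) x -> V (cmap (chart_at p) x).
    by move/subspace_continuousP : cmapc => /(_ _ pp) /(_ _ nV).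
  have nd : \forall x \near p, cdom (chart_at p) x.
    exact: (open_near (chart_open ap) pp).
  by apply: filterS2 nVp nd => x xV xd; split=> //; exact: xV.
have FU x : U x -> cdom (chart_at (F p)) (F x) /\
    cmap (chart_at (F p)) (F x) = G (cmap (chart_at p) x).
  move=> /UV[px Vx]; have [_ _ + +] := hG _ Vx (cmap_model ap px).
  by rewrite cmapK.
split.
  exists U; split=> //; first exact: open_interior.
  by move=> x /FU[].
exists U; split=> //; [exact: open_interior|by move=> x /UV[]|].
move=> _ [x [Ux _] <-]; have [px Vx] := UV _ Ux.
exists V, G; split=> // _ [y [Uy _] <-] _.
have [py _] := UV _ Uy; rewrite /= cmapK //.
by have [] := FU _ Uy.
Qed.

Lemma local_rep_comp (R : realType) (b0 b1 b2 : bool) (l m k : nat)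
    (S : manifold R b0 l) (M : manifold R b1 m) (N : manifold R b2 k)
    (E : S -> M) (F : M -> N) (s : S)
    (VE : set 'cV[R]_l) (GE : 'cV[R]_l -> 'cV[R]_m)
    (VF : set 'cV[R]_m) (GF : 'cV[R]_m -> 'cV[R]_k) :
  local_rep E s VE GE -> local_rep F (E s) VF GF ->
  exists V, [/\ local_rep (F \o E) s V (GF \o GE), V `<=` VE &
    forall z, V z -> VF (GE z)].
Proof.
move=> [oVE VEs CE hE] [oVF VFs CF hF].
have [as_ ss] := (chart_at_atlas s, chart_at_dom s).
have GEs : GE (cmap (chart_at s) s) = cmap (chart_at (E s)) (E s).
  by have [_ _ _ <-] := hE _ VEs (cmap_model as_ ss); rewrite cmapK.
pose V := (VE `&` GE @^-1` VF)°.
have VV : V `<=` VE `&` GE @^-1` VF by exact: interior_subset.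
exists V; split; [|by move=> z /VV[]|by move=> z /VV[]].
split.
- exact: open_interior.
- have nVE : \forall z \near cmap (chart_at s) s, VE z.
    by exact: (open_near oVE VEs).
  have nVF : \forall y \near GE (cmap (chart_at s) s), VF y.
    by apply: (open_near oVF) => //; rewrite GEs.
  have nG : \forall z \near cmap (chart_at s) s, VF (GE z).
    exact: CE 0%N _ VEs _ nVF.
  by apply: filterS2 nVE nG => z; split.
- move=> r; apply: (@Ck_comp _ r _ _ _ V VF).
  + exact: open_interior.
  + by move=> z /VV[].
  + by apply: Ck_subset (CE r) => z /VV[].
  + exact: CF.
- move=> z /VV[VEz VFz] Dz; have [sz zK Ez EGz] := hE _ VEz Dz.
  have Dz' : model R b1 m (GE z).
    by rewrite -EGz; apply: cmap_model => //; exact: chart_at_atlas.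
  have [_ _ Fz FGz] := hF _ VFz Dz'.
  rewrite -EGz cmapK // in Fz FGz; last exact: chart_at_atlas.
  by split=> //=; rewrite FGz EGz.
Qed.

Lemma smooth_map_comp (R : realType) (b0 b1 b2 : bool) (l m k : nat)
    (S : manifold R b0 l) (M : manifold R b1 m) (N : manifold R b2 k)
    (E : S -> M) (F : M -> N) :
  smooth_map setT E -> smooth_map setT F -> smooth_map setT (F \o E).
Proof.
move=> sE sF; apply: local_rep_smooth => s.
have [VE [GE Es]] := smooth_map_local_rep s sE.
have [VF [GF Fs]] := smooth_map_local_rep (E s) sF.
by have [V [FE _ _]] := local_rep_comp Es Fs; exists V, (GF \o GE).
Qed.

Lemma local_rep_at (R : realType) (bd bd' : bool) (m k : nat)
    (M : manifold R bd m) (N : manifold R bd' k) (F : M -> N) (p : M)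
    (V : set 'cV[R]_m) (G : 'cV[R]_m -> 'cV[R]_k) : local_rep F p V G ->
  G (cmap (chart_at p) p) = cmap (chart_at (F p)) (F p).
Proof.
move=> [_ Vp _ hG]; have [ap pp] := (chart_at_atlas p, chart_at_dom p).
by have [_ _ _ <-] := hG _ Vp (cmap_model ap pp); rewrite cmapK.
Qed.

Lemma mdiff_comp (R : realType) (b0 b1 b2 : bool) (l m k : nat)
    (S : manifold R b0 l) (M : manifold R b1 m) (N : manifold R b2 k)
    (E : S -> M) (F : M -> N) (s : S) (a : 'cV[R]_l) :
  smooth_map setT E -> smooth_map setT F ->
  mdiff (F \o E) s a = mdiff F (E s) (mdiff E s a).
Proof.
move=> sE sF.
have [VE [GE Es]] := smooth_map_local_rep s sE.
have [VF [GF Fs]] := smooth_map_local_rep (E s) sF.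
have [V [FE _ _]] := local_rep_comp Es Fs.
rewrite (mdiff_local_rep _ FE) (mdiff_local_rep _ Fs) (mdiff_local_rep _ Es).
rewrite -(local_rep_at Es) diff_comp //.
  by have [_ Vs /(_ 1%N)[dE _] _] := Es; exact: dE.
rewrite (local_rep_at Es).
by have [_ Vs /(_ 1%N)[dF _] _] := Fs; exact: dF.
Qed.

(** The Gauss formula for a composite: by the second-order chain rule the second
    derivative of F o E is that of F on the image vectors, up to a vector
    tangent to F. Only the composite appears on the left, so that two
    factorizations of one map can be compared. *)
Lemma cov_comp (R : realType) (b0 b1 b2 : bool) (l m k : nat)
    (S : manifold R b0 l) (M : manifold R b1 m) (N : manifold R b2 k)
    (Gam : connection N) (E : S -> M) (F : M -> N) (s : S) (a b : 'cV[R]_l) :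
  smooth_map setT E -> smooth_map setT F ->
  exists w,
    cov Gam (F \o E) s a (fun x => mdiff (F \o E) x (const_field s b x)) =
    cov Gam F (E s) (mdiff E s a)
      (fun x => mdiff F x (const_field (E s) (mdiff E s b) x))
    + mdiff F (E s) w.
Proof.
move=> sE sF.
have [VE [GE Es]] := smooth_map_local_rep s sE.
have [VF [GF Fs]] := smooth_map_local_rep (E s) sF.
have [V [FE VVE VVF]] := local_rep_comp Es Fs.
have [oV Vs _ _] := FE; have [oVF VFs CF _] := Fs; have [_ _ CE _] := Es.
exists ('d (fun z => 'd GE z b) (cmap (chart_at s) s) a).
have covFE := cov_const_field Gam a b (smooth_map_comp sE sF) FE.
have covF := cov_const_field Gam (mdiff E s a) (mdiff E s b) sF Fs.
apply: (eq_trans covFE); rewrite covF.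
have dFE X := mdiff_comp s X sE sF; rewrite !dFE addrAC; congr (_ + _).
rewrite (mdiff_local_rep _ Fs) !(mdiff_local_rep _ Es) -(local_rep_at Es).
exact: (diff2_comp a b oV Vs oVF VVF (Ck_subset VVE (CE 2%N)) (CF 2%N)).
Qed.

Lemma mdiff_mx (R : realType) (bd bd' : bool) (m k : nat)
    (M : manifold R bd m) (N : manifold R bd' k) (F : M -> N) (p : M) :
  smooth_map setT F -> exists B : 'M[R]_(k, m), mdiff F p =1 mulmx B.
Proof.
move=> /(smooth_map_local_rep p)[V [G FG]].
exists (\matrix_(i, j) 'd G (cmap (chart_at p) p) (delta_mx j 0) i 0) => X.
rewrite (mdiff_local_rep _ FG) diff_basis; last first.
  by have [_ Vp /(_ 1%N)[dG _] _] := FG; exact: dG.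
apply/matrixP => i j; rewrite !mxE summxE ord1; apply: eq_bigr => c _.
rewrite !mxE mulrC deriveE //.
by have [_ Vp /(_ 1%N)[dG _] _] := FG; exact: dG.
Qed.

(** * Comparison of the tangent spaces along the boundary *)

(** Two factorizations F o E = I o J of one map, with I totally geodesic: the
    second fundamental forms of F and I agree modulo tangent vectors, and that
    of I is itself tangent to I. *)
Lemma cov_tangent (R : realType) (b0 b1 b2 b3 : bool) (l m n k : nat)
    (S : manifold R b0 l) (M : manifold R b1 m) (P : manifold R b2 n)
    (N : manifold R b3 k) (Gam : connection N) (E : S -> M) (F : M -> N)
    (J : S -> P) (I : P -> N) (s : S) (a b : 'cV[R]_l) :
  smooth_map setT E -> smooth_map setT F -> smooth_map setT J ->
  smooth_map setT I -> F \o E = I \o J -> totally_geodesic Gam I ->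
  exists w z, cov Gam F (E s) (mdiff E s a)
      (fun x => mdiff F x (const_field (E s) (mdiff E s b) x)) =
    mdiff F (E s) w + mdiff I (J s) z.
Proof.
move=> sE sF sJ sI FE tg.
have [BF hF] := mdiff_mx (E s) sF; have [BI hI] := mdiff_mx (J s) sI.
have [w covF] := cov_comp Gam s a b sE sF.
have [z covI] := cov_comp Gam s a b sJ sI.
have [z' Iz'] := tg _ _ (chart_open (chart_at_atlas (J s)))
  (@const_field_smooth _ _ _ P (J s) (mdiff J s b)) (J s) (mdiff J s a)
  (chart_at_dom (J s)).
exists (- w), (z' + z).
rewrite hF hI mulmxN mulmxDr -hF -!hI -Iz' -covI -FE covF addrC addrK //.
Qed.

(** The coefficients of the projection onto the column space of B solve the
    normal equations, whose Gram matrix B^T gp B is invertible because gp is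
    positive definite. *)
Lemma orthogonal_projection (R : realType) (k n : nat) (gp : 'M[R]_k)
    (B : 'M[R]_(k, n)) (xi : 'cV[R]_k) :
  (forall x : 'cV[R]_k, x != 0 -> 0 < (x^T *m gp *m x) 0 0) ->
  (forall x : 'cV[R]_n, B *m x = 0 -> x = 0) ->
  exists t, B^T *m gp *m (xi - B *m t) = 0.
Proof.
move=> gpos Binj; pose K := B^T *m gp *m B.
have Ku : K \in unitmx.
  apply: unitmx_inj => x Kx; apply: Binj; apply/eqP; apply/negPn/negP.
  move=> /gpos; rewrite trmx_mul -!mulmxA.
  by rewrite (_ : _ *m (gp *m _) = 0) ?mulmx0 ?mxE ?ltxx // -Kx /K !mulmxA.
exists (invmx K *m (B^T *m gp *m xi)).
by rewrite mulmxBr [X in _ - X]mulmxA -/K mulmxA mulmxV // mul1mx subrr.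
Qed.

Lemma gram_sym (R : realType) (bd : bool) (m : nat) (M : manifold R bd m)
    (g : M -> 'M[R]_m) (p : M) :
  (forall v w, inner g p v w = inner g p w v) -> (g p)^T = g p.
Proof.
have gE i k : inner g p (delta_mx i 0) (delta_mx k 0) = g p i k.
  by rewrite /inner trmx_delta -rowE -colE !mxE.
by move=> gC; apply/matrixP => i k; rewrite mxE -!gE.
Qed.

Lemma mdiff_inj0 (R : realType) (bd bd' : bool) (m k : nat)
    (M : manifold R bd m) (N : manifold R bd' k) (F : M -> N) (p : M)
    (B : 'M[R]_(k, m)) :
  mdiff F p =1 mulmx B -> injective (mdiff F p) ->
  forall x : 'cV[R]_m, B *m x = 0 -> x = 0.
Proof.
by move=> hF Finj x Bx; apply: Finj; rewrite !hF Bx mulmx0.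
Qed.

Lemma innerDl (R : realType) (bd : bool) (m : nat) (M : manifold R bd m)
    (g : M -> 'M[R]_m) (p : M) (v w x : 'cV[R]_m) :
  inner g p (v + w) x = inner g p v x + inner g p w x.
Proof. by rewrite /inner linearD /= !mulmxDl mxE. Qed.

Lemma innerNl (R : realType) (bd : bool) (m : nat) (M : manifold R bd m)
    (g : M -> 'M[R]_m) (p : M) (v x : 'cV[R]_m) :
  inner g p (- v) x = - inner g p v x.
Proof. by rewrite /inner linearN /= !mulNmx mxE. Qed.

Lemma inner_suml (R : realType) (bd : bool) (m q : nat) (M : manifold R bd m)
    (g : M -> 'M[R]_m) (p : M) (c : 'I_q -> R) (v : 'I_q -> 'cV[R]_m)
    (x : 'cV[R]_m) :
  inner g p (\sum_(a < q) c a *: v a) x = \sum_(a < q) c a * inner g p (v a) x.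
Proof.
rewrite /inner linear_sum !mulmx_suml summxE; apply: eq_bigr => a _.
by rewrite linearZ /= -!scalemxAl mxE.
Qed.

Lemma bilinear_mx_eq0 (R : realType) (m n : nat) (B : 'M[R]_(m, n)) :
  (forall (x : 'cV[R]_m) (y : 'cV[R]_n), (x^T *m B *m y) 0 0 = 0) -> B = 0.
Proof.
move=> B0; apply/matrixP => i k; have := B0 (delta_mx i 0) (delta_mx k 0).
by rewrite trmx_delta -rowE -colE !mxE.
Qed.

Lemma hyperplane_span (R : realType) (n l : nat) (K : 'M[R]_n)
    (H : 'M[R]_(n, l)) (v z : 'cV[R]_n) :
  n = l.+1 -> (forall x : 'cV[R]_l, H *m x = 0 -> x = 0) ->
  v^T *m K *m v != 0 -> v^T *m K *m H = 0 ->
  exists c x, z = c *: v + H *m x.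
Proof.
move=> nl; move: K H v z; rewrite {}nl => K H v z Hinj vv vH.
pose Q : 'M[R]_l.+1 := row_mx v H.
have Qu : Q \in unitmx.
  by apply: unitmx_inj => x; exact: (hyperplane_basis Hinj vv vH).
pose x : 'cV[R]_(1 + l) := invmx Q *m z.
exists ((usubmx x) 0 0), (dsubmx x).
by rewrite -row_mx_cV -/Q /x mulmxA mulmxV // mul1mx.
Qed.

Theorem theorem1 (R : realType) (n q : nat)
    (Mbar : manifold R false (n + q)) (P : manifold R false n)
    (Sigma : manifold R false (n - 1)) (M : manifold R true n)
    (g : Mbar -> 'M[R]_(n + q)) (nabla : connection Mbar)
    (oMbar : Mbar -> bool) (oP : P -> bool) (oM : M -> bool)
    (iota : P -> Mbar) (j : Sigma -> P) (Psi : M -> Mbar) (f : M -> Sigma)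
    (eta : Sigma -> 'cV[R]_n) (N : 'I_q -> M -> 'cV[R]_(n + q))
    (A : 'I_q -> M -> 'M[R]_n) (u : mpoly.multinom q) :
  (* the ambient Riemannian manifold *)
  connected [set: Mbar] -> orientation oMbar ->
  riemannian g -> levi_civita g nabla ->
  (* the totally geodesic submanifold P *)
  connected [set: P] -> orientation oP ->
  immersion iota -> injective iota -> totally_geodesic nabla iota ->
  (* the compact hypersurface Sigma of P *)
  compact [set: Sigma] -> immersion j -> injective j ->
  unit_normal_field g iota j eta ->
  (* the submanifold M with boundary Sigma *)
  compact [set: M] -> connected [set: M] -> orientation oM ->
  immersion Psi ->
  diffeo_from (mboundary M) f ->
  (forall p, mboundary M p -> Psi p = iota (j (f p))) ->
  normal_frame g Psi N -> shape_operators g nabla Psi N A ->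
  (* the Newton transformation *)
  (1 <= mpoly.mdeg u <= n - 1)%N -> positive_newton g Psi A u ->
  transversal_along_boundary g Psi iota j f eta N.
Proof.
move=> _ _ [gC gpos _] _ _ _ [sI Iinj] _ tg _ [sJ Jinj] _ [_ eta1 etaJ].
move=> _ _ _ [sF Finj] [_ [e [sE eM fe ef]]] FI frame shape /andP[u0 un] pos.
move=> p pM; apply: contrapT => nex.
have Neta a : inner g (Psi p) (mdiff iota (j (f p)) (eta (f p))) (N a p) = 0.
  by apply/eqP; apply: contrapT => na; apply: nex; exists a; apply/negP.
have FE : Psi \o e = iota \o j.
  by apply/funext => s /=; rewrite (FI _ (eM s)) fe.
have := ef p pM; set s := f p => es; rewrite -/s in Neta.
rewrite -es in Neta; clear pM nex.
have FEs : iota (j s) = Psi (e s) by rewrite -[LHS]/((iota \o j) s) -FE.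
have [BF hF] := mdiff_mx (e s) sF; have [BI hI] := mdiff_mx (j s) sI.
have [BE hE] := mdiff_mx s sE; have [BJ hJ] := mdiff_mx s sJ.
have BFinj := mdiff_inj0 hF (@Finj _); have BIinj := mdiff_inj0 hI (@Iinj _).
have BJinj := mdiff_inj0 hJ (@Jinj _).
have FEIJ (x : 'cV[R]_(n - 1)) : BF *m (BE *m x) = BI *m (BJ *m x).
  rewrite -hF -hE -hI -hJ -(mdiff_comp s x sE sF) -(mdiff_comp s x sJ sI).
  by rewrite FE.
have BEinj (x : 'cV[R]_(n - 1)) : BE *m x = 0 -> x = 0.
  by move=> BEx; apply/BJinj/BIinj; rewrite -FEIJ BEx mulmx0.
set gp := g (Psi (e s)).
have gsym : gp^T = gp by exact: gram_sym (gC (Psi (e s))).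
have gp_pos : forall x : 'cV[R]_(n + q), x != 0 -> 0 < (x^T *m gp *m x) 0 0.
  exact: gpos (Psi (e s)).
have innE v w : inner g (Psi (e s)) v w = (v^T *m gp *m w) 0 0 by [].
have [Nnormal Northo Nspan] := frame (e s).
have n0 : (0 < n)%N by exact: leq_trans (leq_trans u0 un) (leq_subr 1 n).
have nl : n = (n - 1).+1 by rewrite subn1 prednK.
set xi := mdiff iota (j s) (eta s) in Neta.
have hxi : BI *m eta s = xi by rewrite -hI.
have xiJ (x : 'cV[R]_(n - 1)) : (xi^T *m gp *m (BI *m (BJ *m x))) 0 0 = 0.
  by have := etaJ s x; rewrite /pullback /inner FEs -/gp -/xi hI hJ.
have xi1 : (xi^T *m gp *m xi) 0 0 = 1.
  by have := eta1 s; rewrite /pullback /inner FEs -/gp -/xi.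
(* xi = eta is tangent to M: its normal component is a combination of the N a,
   with coefficients <xi, N a> = 0. *)
have [t xiE] : exists t, xi = BF *m t.
  have [t ht] := orthogonal_projection xi gp_pos BFinj; exists t.
  have nt : normal_to g Psi (e s) (xi - BF *m t).
    move=> X; rewrite gC hF innE trmx_mul -!mulmxA [BF^T *m _]mulmxA ht.
    by rewrite mulmx0 mxE.
  have [c xic] := Nspan _ nt; apply/eqP; rewrite -subr_eq0 xic.
  apply/eqP; rewrite big1 // => b _; suff -> : c b = 0 by rewrite scale0r.
  have : inner g (Psi (e s)) (xi - BF *m t) (N b (e s)) = 0.
    by rewrite innerDl innerNl Neta -hF gC Nnormal subrr.
  rewrite xic inner_suml (bigD1 b) //= Northo eqxx mulr1 big1 ?addr0 // => a ab.
  by rewrite Northo (negPf ab) mulr0.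
have t0 : t != 0.
  apply/eqP => tz; move: xi1; rewrite xiE tz !mulmx0 mxE => /eqP.
  by rewrite eq_sym oner_eq0.
pose K := BF^T *m gp *m BF.
have KE (x y : 'cV[R]_n) :
    (x^T *m K *m y) 0 0 = ((BF *m x)^T *m gp *m (BF *m y)) 0 0.
  by rewrite /K trmx_mul !mulmxA.
have Kpos (x : 'cV[R]_n) : x != 0 -> 0 < (x^T *m K *m x) 0 0.
  move=> x0; rewrite KE; apply: gp_pos; apply: contraNneq x0 => /BFinj ->.
  exact: eqxx.
have Ksym : K^T = K by rewrite /K !trmx_mul trmxK gsym mulmxA.
have tBE : t^T *m K *m BE = 0.
  apply: bilinear_mx_eq0 => x y.
  rewrite [x]mx11_scalar tr_scalar_mx mul_scalar_mx -scalemxAl mxE -mulmxA.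
  by rewrite KE -xiE FEIJ xiJ mulr0.
(* T_pP is spanned by eta and T_pSigma, which are both tangent to M. *)
have PM (z : 'cV[R]_n) : exists z', BI *m z = BF *m z'.
  have [||c [x ->]] :=
    @hyperplane_span _ _ _ (BI^T *m gp *m BI) BJ (eta s) z nl BJinj.
  - apply/eqP => /matrixP /(_ 0 0); rewrite !mulmxA -trmx_mul -hI -/xi.
    by rewrite -mulmxA -hI -/xi xi1 mxE => /eqP; rewrite oner_eq0.
  - apply: bilinear_mx_eq0 => x y.
    rewrite [x]mx11_scalar tr_scalar_mx mul_scalar_mx -scalemxAl mxE.
    by rewrite !mulmxA -trmx_mul -hI -/xi -!mulmxA [xi^T *m _]mulmxA xiJ mulr0.
  exists (c *: t + BE *m x).
  by rewrite !mulmxDr -!scalemxAr hxi xiE FEIJ.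
(* The second fundamental form of M vanishes on T_pSigma. *)
have AH a : (A a (e s) *m BE)^T *m K *m BE = 0.
  apply: bilinear_mx_eq0 => x y.
  have := shape _ _ (chart_open (chart_at_atlas (e s)))
    (@const_field_smooth _ _ _ M (e s) (mdiff e s y)) a (e s) (mdiff e s x)
    (chart_at_dom (e s)).
  have [w [z ->]] := cov_tangent s x y sE sF sJ sI FE tg.
  have [z' zE] := PM z.
  rewrite const_field_at hI zE -hF innerDl ![inner g _ (mdiff _ _ _) _]gC.
  rewrite !Nnormal addr0 /pullback /inner !hF !hE -/gp => <-.
  by rewrite -KE [A a (e s) *m (BE *m x)]mulmxA [(_ *m x)^T]trmx_mul !mulmxA.
have := pos (e s) t t0; rewrite /pullback /inner !hF -/gp -KE.
by rewrite (newtonT_conormal nl Ksym Kpos BEinj t0 tBE AH u0) ltxx.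
Qed.
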